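(* Let $R$ be a finite simple connected graph having no leaves and no two distinct vertices with the same closed neighborhood, and let $n\geq 1$. Then the sibling number and the tuft number have joint symmetric distribution on the set of unlabeled connected graphs with $n$ vertices whose reduction is isomorphic to $R$; that is, $\sum_G x^{s(G)}y^{t(G)}$, summed over the isomorphism classes of connected graphs $G$ with $n$ vertices whose reduction is isomorphic to $R$, is symmetric in $x$ and $y$.
   Context: All graphs are finite and simple. The closed neighborhood of a vertex $v$ is $N[v]=\{v\}\cup\{u: u\text{ adjacent to }v\}$. Two distinct vertices are siblings if they have the same closed neighborhood. A leaf is a vertex of degree one. The tuft number $t(G)$ is the maximal number of leaves adjacent to a single vertex ($0$ if there are none); the sibling number is $s(G)=\max_{v}\lvert\{u: N[u]=N[v]\}\rvert-1$. For a connected graph $G$ other than the complete graph $K_2$, its reduction is the graph obtained by repeatedly (i) removing all leaves and (ii) contracting each maximal group of siblings to a single vertex (adjacent to the common neighbors of the group outside it), until a graph with neither leaves nor siblings is reached. *)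

(* Defs.v *)
From mathcomp Require Import all_boot fingroup perm.
Set Implicit Arguments. Unset Strict Implicit. Unset Printing Implicit Defensive.

Section GraphDefs.
Variable V : finType.
Variable e : rel V.

Definition simple_graph : bool :=
  [forall x, ~~ e x x] && [forall x, forall y, e x y == e y x].

Definition connectedb : bool :=
  (0 < #|V|) && [forall x, forall y, connect e x y].

Definition nbhd (x : V) : {set V} := [set y | e x y].
Definition cnbhd (x : V) : {set V} := x |: nbhd x.
Definition is_leaf (x : V) : bool := #|nbhd x| == 1.

Definition tuft : nat := \max_(v : V) #|[set u | e v u & is_leaf u]|.

Definition sibling : nat := (\max_(v : V) #|[set u | cnbhd u == cnbhd v]|) - 1.

Definition isK2 : bool := (#|V| == 2) && [exists x, exists y, (x != y) && e x y].

(* ---- the reduction, tracked as a vertex subset S of V; the current graph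
   is always the subgraph of G induced on S (contracting a sibling group to
   one vertex = keeping one representative, the one of least enum_rank) *)
Definition nbhdS (S : {set V}) (x : V) : {set V} := [set y in S | e x y].
Definition cnbhdS (S : {set V}) (x : V) : {set V} := x |: nbhdS S x.
Definition leavesS (S : {set V}) : {set V} := [set x in S | #|nbhdS S x| == 1].
Definition remove_leaves (S : {set V}) : {set V} := S :\: leavesS S.
Definition contract_siblings (S : {set V}) : {set V} :=
  [set x in S | [forall y in S,
     (cnbhdS S y == cnbhdS S x) ==> (enum_rank x <= enum_rank y)%N]].
Definition red_round (S : {set V}) : {set V} :=
  contract_siblings (remove_leaves S).
(* each round either removes a vertex or is a fixed point (no leaves, no
   siblings), so #|V| rounds reach the end of the process *)
Definition reduction_set : {set V} := iter #|V| red_round setT.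

Definition reduces_to (VR : finType) (eR : rel VR) : bool :=
  [exists f : {ffun VR -> V},
    [&& injectiveb f, f @: [set: VR] == reduction_set &
        [forall u, forall v, eR u v == e (f u) (f v)]]].

End GraphDefs.

Definition graph (n : nat) := {ffun 'I_n * 'I_n -> bool}.
Definition adj n (g : graph n) : rel 'I_n := fun x y => g (x, y).

Definition giso n (g h : graph n) : bool :=
  [exists p : {perm 'I_n}, [forall x, forall y, g (x, y) == h (p x, p y)]].

Definition graphs_st (VR : finType) (eR : rel VR) (n a b : nat) : {set graph n} :=
  [set g : graph n | [&& simple_graph (adj g), connectedb (adj g),
     ~~ isK2 (adj g), reduces_to (adj g) eR,
     sibling (adj g) == a & tuft (adj g) == b]].

(* number of isomorphism classes among them = coefficient of x^a y^b in
   sum_G x^{s(G)} y^{t(G)} over unlabeled G *)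
Definition num_classes (VR : finType) (eR : rel VR) (n a b : nat) : nat :=
  #|[set [set h in graphs_st eR n a b | giso g h] | g in graphs_st eR n a b]|.

(* Main.v *)
(* Idea. Call a set of two or more siblings, or a vertex with some of its leaves,
   a blob, and give a graph decorated with disjoint blobs the sign
   (-1)^(number of blobs); blobs of siblings have a + 2 vertices, blobs of leaves
   b + 1 leaves. Collapsing the blobs to their centres and expanding them again
   with the two kinds exchanged is an isomorphism-invariant bijection from the
   graphs decorated with parameters (a, b) to those decorated with parameters
   (b, a). It preserves the reduction, because deleting leaves and merging
   siblings one at a time is a confluent process. On the other hand, sum the sign
   (-1)^(number of cycles on the blobs) over all automorphisms s of a fixed graph
   and all decorations invariant under s. Two blobs in the same class of siblings
   can be exchanged by an automorphism, so such decorations cancel; the remaining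
   ones over a given set of classes of siblings and of tufts are permuted
   transitively by automorphisms fixing every class, so one is left with the
   invariant subsets of the set of classes of at least a + 2 siblings and tufts
   of at least b + 1 leaves, and these cancel by toggling a cycle unless there is
   no such class. By Burnside's lemma the number of isomorphism classes with
   s <= a and t <= b is therefore the signed count of decorated graphs, which is
   symmetric in a and b. *)
Require Import Defs.
From mathcomp Require Import all_boot fingroup perm.
From mathcomp Require Import all_order all_algebra morphism action.
Set Implicit Arguments. Unset Strict Implicit. Unset Printing Implicit Defensive.
Import GRing.Theory Num.Theory.

(** * Dismantling by leaves and siblings *)

Section Dismantling.
Variables (VR : finType) (eR : rel VR).

Section OneGraph.
Variables (V : finType) (e : rel V).

Definition sib_in (S : {set V}) (x y : V) :=
  [/\ x != y, e x y & forall z, z \in S -> z != x -> z != y -> e x z = e y z].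

Definition leaf_in (S : {set V}) (x y : V) :=
  [/\ x != y, e x y & forall z, z \in S -> e x z -> z = y].

Definition removable (S : {set V}) (x y : V) := sib_in S x y \/ leaf_in S x y.

(** Vertices are deleted one at a time, so that their order can be varied; the current graph is
    always the one induced on [S], and the process ends at an induced copy of [eR]. *)
Inductive dismantles : {set V} -> Prop :=
| dismantles_iso (f : VR -> V) : injective f ->
    (forall u v, eR u v = e (f u) (f v)) -> dismantles (f @: [set: VR])
| dismantles_step (S : {set V}) (x y : V) : x \in S -> y \in S ->
    removable S x y -> dismantles (S :\ x) -> dismantles S.

Lemma removable_sub (S S' : {set V}) x y :
  S' \subset S -> removable S x y -> removable S' x y.
Proof.
move=> /subsetP sub [[ne exy H]|[ne exy H]]; [left|right]; split=> // z /sub;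
  exact: H.
Qed.

Lemma removable_adj S x y : removable S x y -> e x y.
Proof. by case=> -[]. Qed.

Lemma removable_neq S x y : removable S x y -> x != y.
Proof. by case=> -[]. Qed.

End OneGraph.

(** Serves three purposes: exchanging two siblings, renaming vertices, and passing to another graph
    that agrees with the first on [S]. *)
Lemma dismantles_morph (V V' : finType) (e : rel V) (e' : rel V') (h : V -> V')
    (S : {set V}) :
    {in S &, injective h} -> {in S &, forall x y, e x y = e' (h x) (h y)} ->
  dismantles e S -> dismantles e' (h @: S).
Proof.
move=> hinj he D; elim: D hinj he => {S} [f finj fe|S x y xS yS rm _ IH] hinj he.
  rewrite -imset_comp; apply: dismantles_iso => [u v /hinj|u v].
    by rewrite !imset_f ?inE // => /(_ isT isT) /finj.
  by rewrite fe he ?imset_f.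
have sub z : z \in S :\ x -> z \in S by rewrite in_setD1 => /andP[].
have eqS : h @: (S :\ x) = h @: S :\ h x.
  apply/setP=> z; rewrite in_setD1; apply/imsetP/andP=> [[w]|[ne /imsetP[w wS zw]]].
    rewrite in_setD1 => /andP[wx wS] ->; split; last exact: imset_f.
    by apply: contra wx => /eqP /hinj -> .
  exists w => //; rewrite in_setD1 wS andbT; apply: contra ne => /eqP <-.
  by rewrite zw.
apply: (@dismantles_step _ _ _ (h x) (h y)); rewrite ?imset_f //; last first.
  rewrite -eqS; apply: IH => u v /sub uS /sub vS; [exact: hinj | exact: he].
have hne u v : u \in S -> v \in S -> h u != h v -> u != v.
  by move=> _ _; apply: contra => /eqP ->.
have hne' : x != y -> h x != h y by apply: contra => /eqP /hinj -> .
case: rm => [[ne exy H]|[ne exy H]]; [left|right]; split; rewrite -?he ?hne' //.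
  move=> z /imsetP[w wS ->] /(hne _ _ wS xS) wx /(hne _ _ wS yS) wy.
  by rewrite -!he // H.
by move=> z /imsetP[w wS ->]; rewrite -he // => /H ->.
Qed.

Hypothesis leafless : forall v, ~~ is_leaf eR v.
Hypothesis sibless : forall u v, cnbhd eR u = cnbhd eR v -> u = v.

(** * Confluence of one-vertex removals *)

Section Confluence.
Variables (V : finType) (e : rel V).
Hypothesis esimple : simple_graph e.

Lemma simple_irr x : e x x = false.
Proof. by case/andP: esimple => /forallP/(_ x)/negbTE. Qed.

Lemma simple_sym x y : e x y = e y x.
Proof. by case/andP: esimple => _ /forallP/(_ x)/forallP/(_ y)/eqP. Qed.

Lemma sib_in_sym (S : {set V}) x y : sib_in e S x y -> sib_in e S y x.
Proof.
case=> ne exy H; split; rewrite 1?eq_sym 1?simple_sym // => z zS zy zx.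
by rewrite H.
Qed.

Lemma target_not_removable (f : VR -> V) x y : injective f ->
    (forall u v, eR u v = e (f u) (f v)) ->
    x \in f @: [set: VR] -> y \in f @: [set: VR] ->
  ~ removable e (f @: [set: VR]) x y.
Proof.
move=> finj fe /imsetP[u _ ->] /imsetP[v _ ->] [[ne exy H]|[ne exy H]].
  have nuv : u != v by apply: contra ne => /eqP ->.
  case/eqP: nuv; apply: sibless; apply/setP=> w; rewrite !inE !fe.
  have [->|wu] := eqVneq w u; first by rewrite simple_sym exy orbT.
  have [->|wv] := eqVneq w v; first by rewrite exy orbT.
  by rewrite /= H ?(inj_eq finj) ?imset_f.
case/negP: (leafless u); apply/cards1P; exists v; apply/setP=> w; rewrite !inE fe.
apply/idP/eqP=> [euw|->//]; apply: finj; apply: H => //; exact: imset_f.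
Qed.

(* Local confluence: if the witness of one removal is the other removed vertex,
   then the two vertices are siblings, and removing either gives the same graph. *)
Lemma removable_exchange (S : {set V}) x y x' y' :
    x \in S -> x' \in S -> y \in S -> y' \in S -> x != x' ->
    removable e S x y -> removable e S x' y' ->
  sib_in e S x x' \/ (y != x' /\ y' != x).
Proof.
move=> xS x'S yS y'S ne.
suff half u v u' v' : u \in S -> u' \in S -> v' \in S -> u != u' ->
    removable e S u v -> removable e S u' v' -> sib_in e S u u' \/ v != u'.
  move=> rx rx'; case: (half _ _ _ _ xS x'S y'S ne rx rx') => [|h1]; first by left.
  rewrite eq_sym in ne; case: (half _ _ _ _ x'S xS yS ne rx' rx) => [/sib_in_sym|h2].
    by left.
  by right.
move=> uS u'S v'S nu ru ru'; case: (eqVneq v u') => [vu'|]; last by right.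
left; subst v; case: ru => [//|[_ euu' H]]; split=> // z zS zu zu'.
have -> : e u z = false by apply/negP=> /(H z zS)/eqP; rewrite (negbTE zu').
apply/esym/negP=> eu'z; case: ru' => [[n1 e1 H1]|[n1 e1 H1]].
  have [v'z|v'u] := eqVneq v' u.
    subst v'; have := H1 _ zS zu' zu; rewrite eu'z => /esym/(H z zS)/eqP.
    by rewrite (negbTE zu').
  have := H1 _ uS nu; rewrite eq_sym v'u => /(_ isT).
  rewrite simple_sym euu' simple_sym => /esym euv'.
  by case/eqP: n1; rewrite (H v').
have uv' : u = v' by apply: H1 uS _; rewrite simple_sym.
by case/eqP: zu; rewrite uv'; apply: H1.
Qed.

(** Any removable vertex may go first. In a given dismantling, the first removal either commutes
    with that of [x], or the two vertices are siblings and the two remaining graphs are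
    isomorphic. *)
Lemma dismantles_remove (S : {set V}) x y : x \in S -> y \in S ->
  removable e S x y -> dismantles e S -> dismantles e (S :\ x).
Proof.
move=> xS yS rm D; elim: D x y xS yS rm => {S} [f finj fe|S x' y' x'S y'S rm' D IH].
  by move=> x y xS yS /(target_not_removable finj fe xS yS).
move=> x y xS yS rm; case: (eqVneq x x') => [-> //|ne].
case: (removable_exchange xS x'S yS y'S ne rm rm') => [sxx'|[yx' y'x]].
  (* Transposing the two siblings carries one remaining graph to the other. *)
  have -> : S :\ x = tperm x x' @: (S :\ x').
    apply/setP=> z; rewrite in_setD1; apply/andP/imsetP=> [[zx zS]|[w]].
      have [->|zx'] := eqVneq z x'.
        by exists x; rewrite ?tpermL // in_setD1 ne.
      by exists z; rewrite ?tpermD // 1?eq_sym // in_setD1 zx'.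
    rewrite in_setD1 => /andP[wx' wS] ->; have [->|wx] := eqVneq w x.
      by rewrite tpermL eq_sym.
    by rewrite tpermD // eq_sym.
  apply: dismantles_morph D => [u v _ _ /perm_inj //|].
  case: sxx' => _ exx' H u v; rewrite !in_setD1 => /andP[ux' uS] /andP[vx' vS].
  have [->|ux] := eqVneq u x; have [->|vx] := eqVneq v x; rewrite ?tpermL.
  - by rewrite !simple_irr.
  - by rewrite tpermD 1?eq_sym // H.
  - by rewrite tpermD 1?[x == _]eq_sym 1?[x' == _]eq_sym // ![e u _]simple_sym H.
  by rewrite !tpermD // eq_sym.
have sub z : S :\ z \subset S by apply: subD1set.
apply: (@dismantles_step _ _ _ x' y').
- by rewrite in_setD1 eq_sym ne.
- by rewrite in_setD1 y'x.
- exact: removable_sub rm'.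
rewrite setDDl setUC -setDDl; apply: (IH x y).
- by rewrite in_setD1 ne.
- by rewrite in_setD1 yx'.
exact: removable_sub rm.
Qed.

(** Each witness lies outside [D], so it is still present whatever part of [D] has already gone, and
    the vertices of [D] can be removed one by one. *)
Lemma dismantles_setD (S D : {set V}) :
    (forall x, x \in D -> x \in S) ->
    (forall x, x \in D -> exists2 y, y \in S :\: D & removable e S x y) ->
  dismantles e S <-> dismantles e (S :\: D).
Proof.
move: {2}#|D| (erefl #|D|) => m; elim: m S D => [|m IH] S D.
  by move/eqP; rewrite cards_eq0 => /eqP -> _ _; rewrite setD0.
move=> cD sub wit; have [x xD] : exists x, x \in D.
  by apply/set0Pn; rewrite -card_gt0 cD.
have [y yD rm] := wit x xD; have xS := sub x xD.
have yS : y \in S by case/setDP: yD.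
have eqD : S :\: D = (S :\ x) :\: (D :\ x).
  apply/setP=> z; rewrite !inE; case: (eqVneq z x) => [->|] //=.
  by rewrite xD.
have stepS : dismantles e S <-> dismantles e (S :\ x).
  by split; [exact: (dismantles_remove xS yS)|exact: (dismantles_step xS yS)].
apply: (iff_trans stepS); rewrite eqD; apply: IH.
- by apply/eqP; rewrite -eqSS -cD (cardsD1 x D) xD.
- by move=> z; rewrite !in_setD1 => /andP[-> /sub].
move=> z; rewrite in_setD1 => /andP[zx /wit[w wD rmw]]; exists w.
  by rewrite -eqD.
exact: removable_sub (subD1set _ _) rmw.
Qed.

(** A removed vertex is adjacent to its witness, so every vertex is joined to the remaining set and
    finally to the copy of [eR]. This yields connectedness of expanded graphs. *)
Lemma dismantles_connect (S : {set V}) : connectedb eR -> dismantles e S ->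
  {in S &, forall x y, connect e x y}.
Proof.
move=> /andP[_ conR]; elim=> {S} [f finj fe|S x y xS yS rm _ IH] u v.
  case/imsetP=> u' _ ->; case/imsetP=> v' _ ->.
  have /connectP[p pp ->] := forallP (forallP conR u') v'.
  apply/connectP; exists (map f p); last by rewrite last_map.
  by rewrite path_map; apply: sub_path pp => a b; rewrite fe.
have csym a b : connect e a b = connect e b a.
  by apply: sym_connect_sym => c d; exact: simple_sym.
have near z : z \in S -> exists2 z', z' \in S :\ x & connect e z z'.
  move=> zS; have [->|zx] := eqVneq z x; last by exists z; rewrite ?in_setD1 ?zx.
  exists y; last exact: connect1 (removable_adj rm).
  by rewrite in_setD1 yS andbT eq_sym (removable_neq rm).
case/near=> u' u'S cu; case/near=> v' v'S cv.
by apply: connect_trans cu _; rewrite csym in cv; apply: connect_trans cv; apply: IH.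
Qed.

(** * Rounds of the reduction as dismantlings *)

Definition no_adjacent_leaves (S : {set V}) :=
  forall x y, x \in S -> y \in S -> leaf_in e S x y -> ~ leaf_in e S y x.

Lemma leavesSP (S : {set V}) x :
  reflect (x \in S /\ exists2 y, y \in S & leaf_in e S x y) (x \in leavesS e S).
Proof.
rewrite inE; apply: (iffP andP) => -[xS].
  case/cards1P=> y /setP nx; split=> //; have := nx y.
  rewrite !inE eqxx => /andP[yS exy]; exists y => //; split=> // [|z zS exz].
    by apply: contraTneq exy => ->; rewrite simple_irr.
  by have := nx z; rewrite !inE zS exz => /esym/eqP.
case=> y yS [_ exy H]; split=> //; apply/cards1P; exists y; apply/setP=> z.
rewrite !inE; apply/andP/eqP => [[zS]|->//]; exact: H.
Qed.

Lemma cnbhdS_sib (S : {set V}) x y : x \in S -> y \in S -> x != y ->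
  cnbhdS e S x = cnbhdS e S y <-> sib_in e S x y.
Proof.
move=> xS yS ne; split=> [/setP eqN|[_ exy H]].
  have exy : e x y.
    by have := eqN y; rewrite !inE yS eqxx /= eq_sym (negbTE ne).
  split=> // z zS zx zy; have := eqN z.
  by rewrite !inE zS (negbTE zx) (negbTE zy).
apply/setP=> z; rewrite !inE.
have [->|zx] := eqVneq z x; first by rewrite xS simple_sym exy orbT.
have [->|zy] := eqVneq z y; first by rewrite yS exy.
by case: (boolP (z \in S)) => //= zS; rewrite H.
Qed.

Lemma contract_siblings_rep (S : {set V}) x : x \in S ->
  exists2 y, y \in contract_siblings e S & cnbhdS e S x = cnbhdS e S y.
Proof.
move=> xS; pose P := [pred y in S | cnbhdS e S y == cnbhdS e S x].
have Px : P x by rewrite /= xS eqxx.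
case: (arg_minnP (fun y : V => enum_rank y : nat) Px) => y /andP[yS /eqP yx] ymin.
exists y => //; rewrite inE yS; apply/forallP=> z; apply/implyP=> zS.
by apply/implyP=> /eqP zy; apply: ymin; rewrite /= zS zy yx eqxx.
Qed.

Lemma contract_siblings_inj (S : {set V}) :
  {in contract_siblings e S &, injective (cnbhdS e S)}.
Proof.
move=> x y; rewrite !inE => /andP[xS /forallP Hx] /andP[yS /forallP Hy] eqN.
apply: enum_rank_inj; apply/val_inj/eqP; rewrite eqn_leq.
have := Hx y; rewrite yS eqN eqxx /= => ->.
by have := Hy x; rewrite xS eqN eqxx /= => ->.
Qed.

(** A discarded vertex has the same closed neighborhood in [S] as its kept representative, so it
    cannot separate two kept vertices that no kept vertex separates. Siblings after the contraction
    would have been siblings in [S]. *)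
Lemma contract_siblings_sibless (S : {set V}) x y :
    x \in contract_siblings e S -> y \in contract_siblings e S ->
  ~ sib_in e (contract_siblings e S) x y.
Proof.
move=> xC yC [ne exy H]; case/eqP: (ne); apply: (contract_siblings_inj xC yC).
have sub z : z \in contract_siblings e S -> z \in S by rewrite inE => /andP[].
have [xS yS] := (sub _ xC, sub _ yC); apply/cnbhdS_sib => //.
split=> // z zS zx zy; have [w wC eqN] := contract_siblings_rep zS.
have [wz|zw] := eqVneq w z; first by apply: H; rewrite // -wz.
rewrite eq_sym in zw; have [_ ezw Hzw] := (cnbhdS_sib zS (sub _ wC) zw).1 eqN.
have [wx|wx] := eqVneq w x.
  have e1 : e z y = e x y by rewrite -wx Hzw // 1?eq_sym // wx.
  by rewrite [e y z]simple_sym e1 exy simple_sym -wx ezw.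
have [wy|wy] := eqVneq w y.
  have e1 : e z x = e y x by rewrite -wy Hzw // 1?eq_sym // wy eq_sym.
  by rewrite [e x z]simple_sym e1 simple_sym exy simple_sym -wy ezw.
rewrite [e x z]simple_sym [e y z]simple_sym !Hzw // 1?eq_sym //.
by rewrite ![e w _]simple_sym H.
Qed.

Lemma sub_red_round (S : {set V}) : red_round e S \subset S.
Proof. by apply/subsetP=> x; rewrite !inE => /andP[/andP[_ ->]]. Qed.

(** Two adjacent leaves have no other neighbors, hence are siblings, and the contraction leaves
    none. *)
Lemma red_round_no_adjacent_leaves (S : {set V}) :
  no_adjacent_leaves (red_round e S).
Proof.
move=> x y xS yS [ne exy Hx] [_ _ Hy].
apply: (contract_siblings_sibless xS yS); split=> // z zS zx zy.
apply/idP/idP=> [/Hx -/(_ zS) E|/Hy -/(_ zS) E]; first by rewrite E eqxx in zy.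
by rewrite E eqxx in zx.
Qed.

(** Two adjacent leaves would vanish together in a round, while single removals keep one of them.
    With [nal] the neighbor of a leaf survives as its witness; a contracted vertex has its
    representative as witness. *)
Lemma dismantles_red_round (S : {set V}) : no_adjacent_leaves S ->
  dismantles e S <-> dismantles e (red_round e S).
Proof.
move=> nal; apply: (iff_trans (B := dismantles e (remove_leaves e S))).
  apply: dismantles_setD => x; first by case/leavesSP.
  case/leavesSP=> xS [y yS lxy]; exists y; last by right.
  rewrite inE yS andbT; apply/leavesSP=> -[_ [w wS lyw]].
  apply: (nal x y) => //; suff -> : x = w by [].
  by case: lyw => _ _; apply=> //; rewrite simple_sym; case: lxy.
set T := remove_leaves e S.
have sub : contract_siblings e T \subset T by apply/subsetP=> x; rewrite inE => /andP[].
have -> : red_round e S = T :\: (T :\: contract_siblings e T).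
  by rewrite setDDr setDv set0U; apply/esym/setIidPr.
apply: dismantles_setD => x; first by case/setDP.
case/setDP=> xT xC; have [y yC eqN] := contract_siblings_rep xT.
have yT := subsetP sub _ yC; exists y.
  by rewrite setDDr setDv set0U inE yT.
by left; apply/cnbhdS_sib => //; apply: contraNneq xC => ->.
Qed.

Lemma red_round_fix_stuck (S : {set V}) x y : red_round e S = S ->
  x \in S -> y \in S -> ~ removable e S x y.
Proof.
move=> fixS xS yS [sxy|lxy].
  have E : remove_leaves e S = S.
    apply/eqP; rewrite eqEsubset subsetDl -{1}fixS.
    by apply/subsetP=> z; rewrite inE => /andP[].
  by move: sxy; rewrite -fixS /red_round E in xS yS *;
     exact: contract_siblings_sibless.
have : x \in leavesS e S by apply/leavesSP; split=> //; exists y.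
by move: xS; rewrite -{1}fixS !inE => /andP[/andP[/negbTE ->]].
Qed.

Lemma red_round_reduction_set :
  red_round e (reduction_set e) = reduction_set e.
Proof.
(* After [k] rounds either a fixed point is reached or at least [k] vertices are gone; for
   [k = #|V|] the second case leaves the empty set, which is fixed too. *)
have [//|lt] : red_round e (reduction_set e) = reduction_set e \/
    #|reduction_set e| + #|V| <= #|V|.
  rewrite /reduction_set; elim: {1 2 3 4}#|V| => [|k [IH|IH]].
  - by right; rewrite addn0 max_card.
  - by left; rewrite !iterS !IH.
  set S := iter k _ _ in IH *; rewrite iterS -/S.
  have [E|ne] := eqVneq (red_round e S) S; first by left; rewrite !E.
  right; apply: leq_trans IH; rewrite addnS -addSn leq_add2r.
  by apply: proper_card; rewrite properEneq ne sub_red_round.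
have E : reduction_set e = set0.
  by apply/eqP; rewrite -cards_eq0 -leqn0 -(leq_add2r #|V|).
by apply/eqP; rewrite E -subset0 sub_red_round.
Qed.

(** Rounds preserve being dismantlable in both directions, and the final set is stuck, so a
    dismantling of it has no steps and is an isomorphism with [eR]. *)
Lemma reduces_toP : no_adjacent_leaves setT ->
  reduces_to e eR <-> dismantles e setT.
Proof.
move=> nal; apply: (iff_trans (B := dismantles e (reduction_set e))); last first.
  suff [D _] : (dismantles e setT <-> dismantles e (reduction_set e)) /\
    no_adjacent_leaves (reduction_set e) by apply: iff_sym.
  rewrite /reduction_set; elim: #|V| => [|k [IH nal']]; first by split.
  split; last exact: red_round_no_adjacent_leaves.
  apply: (iff_trans IH); exact: dismantles_red_round.
have stuck := red_round_fix_stuck red_round_reduction_set.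
split=> [/existsP[f /and3P[/injectiveP finj /eqP <- /forallP fe]]|D].
  by apply: dismantles_iso => // u v; apply/eqP; have /forallP := fe u.
have [S eqS] : exists S, S = reduction_set e by exists (reduction_set e).
rewrite -eqS in D stuck; case: D eqS stuck => [f finj fe E _|{}S x y xS yS rm _ _ H].
  apply/existsP; exists [ffun u => f u]; apply/and3P; split.
  - by apply/injectiveP=> u v; rewrite !ffunE => /finj.
  - by rewrite -E; apply/eqP/eq_imset=> u; rewrite ffunE.
  by apply/forallP=> u; apply/forallP=> v; rewrite !ffunE fe.
by case: (H x y).
Qed.

(** A pair of adjacent leaves is closed under adjacency, so by connectedness it is the whole
    graph. *)
Lemma connected_no_adjacent_leaves :
  connectedb e -> ~~ isK2 e -> no_adjacent_leaves setT.
Proof.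
move=> /andP[_ con] nK2 x y _ _ [ne exy Hx] [_ _ Hy]; case/negP: nK2.
have only z : (z == x) || (z == y).
  have /connectP[p pp ->] := forallP (forallP con x) z.
  have: (x == x) || (x == y) by rewrite eqxx.
  elim: p {1 2 4 5 7}x pp => //= w p IH v /andP[evw pp] xv; apply: IH => //.
  case/orP: xv => /eqP vE; rewrite vE in evw.
    by rewrite (Hx w (in_setT w) evw) eqxx orbT.
  by rewrite (Hy w (in_setT w) evw) eqxx.
rewrite /isK2; apply/andP; split; last first.
  by apply/existsP; exists x; apply/existsP; exists y; rewrite ne.
rewrite -cardsT (_ : setT = [set x; y]) ?cards2 ?ne //.
by apply/setP=> z; rewrite !inE only.
Qed.

End Confluence.
End Dismantling.

(** * Signs of permutations and signed orbit counts *)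

Section CycleSign.
Variable T : finType.
Implicit Types (s t : {perm T}) (X : {set T}).

Definition cycle_sign s X : int := ((-1) ^+ #|porbit s @: X|)%R.

Lemma astabs_perm s X : {in X, forall x, s x \in X} -> s \in ('N(X | 'P))%g.
Proof. by move=> sX; rewrite !inE; apply/subsetP=> x xX; rewrite inE /= apermE sX. Qed.

Lemma porbit_stable s X x : {in X, forall x, s x \in X} -> x \in X ->
  porbit s x \subset X.
Proof.
move=> sX xX; apply/subsetP=> y /porbitP[i ->].
elim: i => [|i IH]; first by rewrite expg0 perm1.
by rewrite expgSr permM sX.
Qed.

(** The parity of a permutation is that of the number of points plus the number of cycles, so on a
    stable set the cycle sign is the usual sign up to the factor [(-1)^#|X|]. *)
Lemma cycle_sign_restr s X : {in X, forall x, s x \in X} ->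
  cycle_sign s X = ((-1) ^+ (odd #|X| (+) restr_perm X s))%R.
Proof.
move=> sX; have sN := astabs_perm sX; set t := restr_perm X s.
have tX x : x \in X -> porbit t x = porbit s x.
  move=> xX; have tsi i : (t ^+ i)%g x = (s ^+ i)%g x.
    elim: i => [|i IH]; first by rewrite !expg0.
    rewrite !expgSr !permM IH restr_permE //.
    by apply: (subsetP (porbit_stable sX xX)); apply: mem_porbit.
  by apply/setP=> y; apply/porbitP/porbitP => -[i ->]; exists i; rewrite tsi.
have tC x : x \notin X -> porbit t x = [set x].
  move=> xX; have t1 : t x = x by apply: (out_perm (restr_perm_on _ _)).
  apply/setP=> y; rewrite inE; apply/porbitP/eqP => [[i ->]|->].
    by elim: i => [|i IH]; rewrite ?expg0 ?perm1 // expgSr permM IH.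
  by exists 0; rewrite expg0 perm1.
(* Outside [X] the restricted permutation is the identity and has one cycle for each point. *)
have orbt : porbits t = porbit s @: X :|: set1 @: (~: X).
  rewrite /porbits; apply/setP=> P; apply/imsetP/setUP => [[x _ ->]|].
    have [xX|xX] := boolP (x \in X).
      by left; rewrite tX // imset_f.
    by right; rewrite tC // imset_f ?inE.
  case=> /imsetP[x]; first by exists x; rewrite ?tX.
  by rewrite inE => xX ->; exists x; rewrite ?tC.
have cardt : #|porbits t| = #|porbit s @: X| + #|~: X|.
  rewrite orbt cardsU (card_imset _ set1_inj).
  suff -> : porbit s @: X :&: set1 @: (~: X) = set0 by rewrite cards0 subn0.
  apply/setP=> P; rewrite !inE; apply/negbTE/andP => -[/imsetP[x xX ->]].
  case/imsetP=> y; rewrite inE => yX E; case/negP: yX.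
  by apply: (subsetP (porbit_stable sX xX)); rewrite E inE.
rewrite /cycle_sign -signr_odd; congr ((-1) ^+ (nat_of_bool _))%R.
rewrite /odd_perm -/t cardt -(cardsC X) !oddD.
by case: (odd #|X|); case: (odd #|~: X|); case: (odd #|_ @: _|).
Qed.

Lemma cycle_signM s t X :
    {in X, forall x, s x \in X} -> {in X, forall x, t x \in X} ->
  cycle_sign (s * t) X = (cycle_sign s X * (-1) ^+ (restr_perm X t))%R.
Proof.
move=> sX tX; have stX : {in X, forall x, (s * t)%g x \in X}.
  by move=> x xX; rewrite permM tX ?sX.
rewrite !cycle_sign_restr // morphM ?astabs_perm // odd_permM addbA.
by rewrite signr_addb.
Qed.

Lemma restr_perm_tperm t X x y : x \in X -> y \in X -> x != y ->
  {in X, forall z, t z = tperm x y z} -> restr_perm X t = true :> bool.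
Proof.
move=> xX yX ne tE; suff -> : restr_perm X t = tperm x y by rewrite odd_tperm ne.
have tN : t \in ('N(X | 'P))%g.
  by apply: astabs_perm => z zX; rewrite tE //; case: tpermP.
apply/permP=> z; have [zX|zX] := boolP (z \in X); first by rewrite restr_permE ?tE.
rewrite (out_perm (restr_perm_on _ _)) // tpermD //.
  by apply: contraNneq zX => <-.
by apply: contraNneq zX => <-.
Qed.

Lemma restr_perm_fix t X : {in X, forall z, t z = z} -> restr_perm X t = false :> bool.
Proof.
move=> tE; suff -> : restr_perm X t = 1%g by rewrite odd_perm1.
have tN : t \in ('N(X | 'P))%g by apply: astabs_perm => z zX; rewrite tE.
apply/permP=> z; rewrite perm1; have [zX|zX] := boolP (z \in X).
  by rewrite restr_permE ?tE.
by rewrite (out_perm (restr_perm_on _ _)).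
Qed.

Lemma imset_perm_stable s X : s @: X = X <-> {in X, forall x, s x \in X}.
Proof.
split=> [E x xX|sX]; first by rewrite -E imset_f.
apply/eqP; rewrite eqEcard card_imset ?leqnn ?andbT //; last exact: perm_inj.
by apply/subsetP=> _ /imsetP[x xX ->]; exact: sX.
Qed.

(* Toggling the orbit of a fixed element of [O] changes the sign. *)
Lemma sum_cycle_sign s (O : {set T}) : {in O, forall x, s x \in O} ->
  (\sum_(X in powerset O | s @: X == X) cycle_sign s X = (O == set0)%:R)%R.
Proof.
move=> sO; have [->|/set0Pn[c cO]] := eqVneq O set0.
  rewrite (big_pred1 set0) ?/cycle_sign ?imset0 ?cards0 // => X.
  rewrite powersetE subset0 /=; case: eqVneq => [->|//]; by rewrite imset0 eqxx.
pose C := porbit s c; have CO : C \subset O by apply: porbit_stable.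
have sC : {in C, forall x, s x \in C}.
  move=> x; rewrite /C -!eq_porbit_mem => /eqP <-.
  by have := porbit_perm s 1 x; rewrite expg1 => ->.
have sCV x : s x \in C -> x \in C.
  move=> sxC; have := porbit_perm s 1 x; rewrite expg1 => E.
  by rewrite /C -!eq_porbit_mem -E eq_porbit_mem in sxC *.
have cC : c \in C by apply: porbit_id.
have CX X : {in X, forall x, s x \in X} -> c \in X -> C \subset X by apply: porbit_stable.
rewrite (bigID (fun X : {set T} => c \in X)) /=.
rewrite (reindex_onto (fun X => X :|: C) (fun X => X :\: C)) /=; last first.
  move=> X /andP[/andP[_ /eqP/imset_perm_stable sX] cX].
  apply/setP=> x; rewrite !inE; have [xC|xC] := boolP (x \in C).
    by rewrite orbT (subsetP (CX X sX cX)).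
  by rewrite orbF.
apply/eqP; rewrite addr_eq0 -sumrN; apply/eqP; apply: eq_big => X.
  rewrite in_setU cC orbT andbT !powersetE subUset CO andbT setDUl setDv setU0.
  apply/andP/andP => [[/andP[XO /eqP/imset_perm_stable sX] /eqP XC]|].
    have cX : c \notin X by rewrite -XC inE cC.
    rewrite XO cX; split=> //; apply/eqP/imset_perm_stable => x xX.
    have := sX x; rewrite !inE xX => /(_ isT)/orP[//|/sCV xC].
    by rewrite -XC inE xC in xX.
  case=> /andP[XO /eqP/imset_perm_stable sX] cX; rewrite XO; split.
    apply/eqP/imset_perm_stable => x; rewrite !inE => /orP[/sX ->//|/sC ->].
    by rewrite orbT.
  apply/eqP/setP=> x; rewrite inE; apply: andb_idl => xX.
  apply: contra cX => xC; apply: (subsetP (porbit_stable sX xX)).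
  by rewrite porbit_sym.
case/andP=> /andP[/andP[_ /eqP/imset_perm_stable sX] _] /eqP XC.
have sX' : {in X, forall x, s x \in X}.
  move=> x xX; have := sX x; rewrite !inE xX => /(_ isT)/orP[//|/sCV xC].
  by rewrite -XC !inE xC in xX.
rewrite /cycle_sign; have -> : porbit s @: (X :|: C) = C |: porbit s @: X.
  rewrite imsetU setUC; congr (_ :|: _); apply/setP=> P; rewrite inE.
  apply/imsetP/eqP => [[x xC ->]|->]; last by exists c.
  by apply/eqP; rewrite /C eq_porbit_mem.
rewrite cardsU1; suff -> : C \notin porbit s @: X.
  by rewrite add1n exprS mulN1r.
apply/imsetP=> -[x xX CE]; have : c \in X.
  by apply: (subsetP (porbit_stable sX' xX)); rewrite -CE.
by rewrite -XC inE cC.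
Qed.

(** An equivariant injection maps cycles bijectively to cycles; it will allow counting cycles on
    blocks instead of centers. *)
Lemma cycle_sign_transport (T' : finType) s (s' : {perm T'}) (h : T -> T')
    (B : {set T}) :
    {in B, forall x, s x \in B} -> {in B, forall x, h (s x) = s' (h x)} ->
    {in B &, injective h} ->
  #|porbit s' @: (h @: B)| = #|porbit s @: B|.
Proof.
move=> sB hs hinj; have si i x : x \in B -> (s ^+ i)%g x \in B.
  by move=> xB; apply: (subsetP (porbit_stable sB xB)); apply: mem_porbit.
have hsi i x : x \in B -> h ((s ^+ i)%g x) = (s' ^+ i)%g (h x).
  move=> xB; elim: i => [|i IH]; first by rewrite !expg0 !perm1.
  by rewrite !expgSr !permM hs ?si // IH.
have orbE x : x \in B -> porbit s' (h x) = h @: porbit s x.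
  move=> xB; apply/setP=> y; apply/porbitP/imsetP => [[i ->]|[z /porbitP[i ->] ->]].
    by exists ((s ^+ i)%g x); rewrite ?mem_porbit ?hsi.
  by exists i; rewrite hsi.
have -> : porbit s' @: (h @: B) = (fun P : {set T} => h @: P) @: (porbit s @: B).
  by rewrite -!imset_comp; apply: eq_in_imset => x xB /=; rewrite orbE.
apply: card_in_imset => _ _ /imsetP[x xB ->] /imsetP[y yB ->].
have sub z : z \in B -> porbit s z \subset B by apply: porbit_stable.
have half u v : u \in B -> v \in B -> h @: porbit s u = h @: porbit s v ->
    porbit s u \subset porbit s v.
  move=> uB vB E; apply/subsetP=> z zP.
  have : h z \in h @: porbit s v by rewrite -E imset_f.
  case/imsetP=> w wP /hinj -> //; first exact: (subsetP (sub u uB)).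
  exact: (subsetP (sub v vB)).
by move=> E; apply/eqP; rewrite eqEsubset !half.
Qed.

End CycleSign.

(* Orbit counting along an equivariant map whose fibres are permuted
   transitively by elements of [G] that do not affect the weight. *)
Lemma sum_fixed_fibre (gT : finGroupType) (G : {group gT}) (E Z : finType)
    (act : E -> gT -> E) (actZ : Z -> gT -> Z) (f : E -> Z)
    (D : {set E}) (Z0 : {set Z}) (w : gT -> Z -> int) :
    (forall x, act x 1%g = x) ->
    (forall x s t, act x (s * t)%g = act (act x s) t) ->
    {in D & G, forall x s, act x s \in D} ->
    {in D & G, forall x s, f (act x s) = actZ (f x) s} ->
    f @: D = Z0 ->
    {in D &, forall x y, f x = f y -> exists2 k, k \in G &
       act x k = y /\ {in G, forall s, actZ (f x) s = f x ->
                                      w (s * k)%g (f x) = w s (f x)}} ->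
  (\sum_(s in G) \sum_(x in D | act x s == x) w s (f x) =
   \sum_(s in G) \sum_(z in Z0 | actZ z s == z) w s z)%R.
Proof.
move=> act1 actM actD fact <- trans.
rewrite (exchange_big_dep [in D]) /=; last by move=> s x _ /andP[].
rewrite (partition_big_imset f) /=.
rewrite [RHS](exchange_big_dep [in f @: D]) /=; last by move=> s z _ /andP[].
apply: eq_bigr => z zD.
pose Ez := [set x in D | f x == z].
pose c x := (\sum_(s in G | act x s == x) w s z)%R.
have -> : (\sum_(x in D | f x == z) \sum_(s in G | (x \in D) && (act x s == x)) w s (f x)
    = \sum_(x in Ez) c x)%R.
  apply: eq_big => [x|x /andP[xD /eqP ->]]; first by rewrite inE.
  by apply: eq_bigl => s; rewrite xD.
have -> : (\sum_(s in G | (z \in f @: D) && (actZ z s == z)) w s z =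
    \sum_(s in G | actZ z s == z) w s z)%R.
  by apply: eq_bigl => s; rewrite zD.
set S := (RHS).
(* The elements fixing [z] are sorted by the point [y] to which they send [x]. Right translation by
   [k] identifies the stabilizer of [x] with the class of [y] and keeps the weight, so each of the
   [#|Ez|] classes sums to [c x]. *)
have cS x : x \in Ez -> (S = c x *+ #|Ez|)%R.
  rewrite inE => /andP[xD /eqP fx].
  rewrite /S (partition_big (act x) [in Ez]) /=; last first.
    move=> s /andP[sG /eqP zs]; rewrite inE actD //= fact // fx zs; exact: eqxx.
  rewrite -sumr_const; apply: eq_bigr => y; rewrite inE => /andP[yD /eqP fy].
  have [k kG [xk wk]] := trans _ _ xD yD (etrans fx (esym fy)).
  rewrite (reindex_inj (mulIg k)) /=; apply: eq_big => [s|s].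
    rewrite groupMr //; case: (boolP (s \in G)) => //= sG.
    rewrite actM -xk; have -> : (act (act x s) k == act x k) = (act x s == x).
      apply/eqP/eqP => [|-> //].
      by move/(congr1 (act^~ k^-1%g)); rewrite -!(actM _ k) mulgV !act1.
    case: (act x s =P x) => xs; last by rewrite andbF.
    by rewrite andbT -fx -fact ?groupM // actM xs xk fy fx eqxx.
  move=> /andP[/andP[skG /eqP zsk] /eqP xsk].
  have sG : s \in G by rewrite -(groupMr s kG).
  rewrite -fx wk //; rewrite -fact //; congr f.
  move: xsk; rewrite actM -xk => /(congr1 (act^~ k^-1%g)).
  by rewrite -!(actM _ k) mulgV !act1.
have [x xD zfx] := imsetP zD.
have xE : x \in Ez by rewrite inE xD zfx eqxx.
have Epos : 0 < #|Ez| by apply/card_gt0P; exists x.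
(* After multiplication by [#|Ez|] every summand becomes [S]. *)
apply: (pmulrnI Epos) => /=; rewrite -sumrMnl (eq_bigr (fun=> S)) => [|y yE].
  by rewrite sumr_const.
by rewrite (cS y yE).
Qed.

(** Equal fiber sizes make the two lists of values rearrangements of each other. The automorphisms
    below are built this way, by matching invariants of points. *)
Lemma perm_of_fibres n (Z : eqType) (F F' : 'I_n -> Z) :
    (forall z, #|[set x | F x == z]| = #|[set x | F' x == z]|) ->
  exists p : {perm 'I_n}, forall x, F' (p x) = F x.
Proof.
move=> E; suff: perm_eq [tuple F i | i < n] [tuple F' i | i < n].
  case/tuple_permP=> p eqp; exists p => x.
  have := congr1 (fun s => nth (F x) s x) eqp.
  rewrite -!tnth_nth !tnth_mktuple; exact: esym.
have cnt (H : 'I_n -> Z) z : count_mem z [tuple H i | i < n] = #|[set x | H x == z]|.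
  rewrite count_map cardsE cardE -size_filter /enum_mem; congr size.
  by rewrite -enumT; apply: eq_filter.
by apply/allP => z _; rewrite /= !cnt E.
Qed.

Lemma sum_prefix_inj (f g : nat -> nat) :
  (forall a, \sum_(i < a) f i = \sum_(i < a) g i) -> f =1 g.
Proof.
by move=> E a; have := E a.+1; rewrite !big_ord_recr /= E => /addnI.
Qed.

(** Passes from counts with both statistics bounded to counts with exact values. *)
Lemma sum_prefix2_inj (f g : nat -> nat -> nat) :
    (forall a b, \sum_(i < a) \sum_(j < b) f i j = \sum_(i < a) \sum_(j < b) g i j) ->
  f =2 g.
Proof.
move=> E a; apply: sum_prefix_inj => b.
by apply: (@sum_prefix_inj (fun i => \sum_(j < b) f i j)
                           (fun i => \sum_(j < b) g i j)) => c; exact: E.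
Qed.

Definition set_perm (T : finType) (s : {perm T}) : {perm {set T}} :=
  perm (imset_inj (@perm_inj T s)).

Lemma set_permE (T : finType) (s : {perm T}) (A : {set T}) : set_perm s A = s @: A.
Proof. exact: permE. Qed.

Lemma set_permM (T : finType) (s t : {perm T}) :
  set_perm (s * t) = (set_perm s * set_perm t)%g.
Proof.
apply/permP=> A; rewrite permM !set_permE -imset_comp.
by apply: eq_imset => x; rewrite /= permM.
Qed.

(** * Configurations of blobs in a graph *)

Definition relabel n (g : graph n) (s : {perm 'I_n}) : graph n :=
  [ffun xy => g ((s^-1)%g xy.1, (s^-1)%g xy.2)].

Lemma relabel1 n (g : graph n) : relabel g 1 = g.
Proof. by apply/ffunP=> -[x y]; rewrite ffunE invg1 !perm1. Qed.

Lemma relabelM n (g : graph n) : act_morph (@relabel n) g.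
Proof. by move=> s t; apply/ffunP=> -[x y]; rewrite !ffunE /= invMg !permM. Qed.

Definition relabel_action n := TotalAction (@relabel1 n) (@relabelM n).

Definition automorphisms n (g : graph n) : {set {perm 'I_n}} :=
  'C[g | relabel_action n]%g.
Canonical automorphisms_group n (g : graph n) := [group of automorphisms g].

Lemma automorphismsP n (g : graph n) (s : {perm 'I_n}) :
  reflect (forall x y, g (s x, s y) = g (x, y)) (s \in automorphisms g).
Proof.
apply: (iffP astab1P) => [E x y|E].
  by rewrite -{1}E /= ffunE /= !permK.
by apply/ffunP=> -[x y]; rewrite ffunE /= -E !permKV.
Qed.

(* A configuration [(r, U, W)] is a retraction [r] whose nontrivial fibres are
   the blobs to be collapsed: those over [U] are to consist of [a + 2] siblings,
   those over [W] of a vertex and [b + 1] leaves attached to it. *)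
Definition config n := ({ffun 'I_n -> 'I_n} * {set 'I_n} * {set 'I_n})%type.

Definition is_config n a b (B : config n) :=
  let: (r, U, W) := B in
  [&& [forall x, r (r x) == r x], [disjoint U & W],
    [forall x in U, #|[set y | r y == x]| == a.+2],
    [forall x in W, #|[set y | r y == x]| == b.+2] &
    [forall x, (r x != x) ==> (r x \in U :|: W)]].

Definition fits n (g : graph n) (B : config n) :=
  let: (r, U, W) := B in
  [forall x, ((r x \in U) ==> (cnbhd (adj g) x == cnbhd (adj g) (r x))) &&
             ((r x \in W) && (r x != x) ==> (nbhd (adj g) x == [set r x]))].

Definition centers n (B : config n) := B.1.2 :|: B.2.

Definition relabel_config n (B : config n) (s : {perm 'I_n}) : config n :=
  let: (r, U, W) := B in ([ffun x => s (r ((s^-1)%g x))], s @: U, s @: W).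

(** Only centers in [U] are compared: leaf blobs with different centers belong to different tufts,
    whereas two blobs of siblings may lie in one class. *)
Definition distinct n (g : graph n) (B : config n) :=
  [forall u in B.1.2, forall v in B.1.2,
     (cnbhd (adj g) u == cnbhd (adj g) v) ==> (u == v)].

Definition fixes n (s : {perm 'I_n}) (B : config n) := relabel_config B s == B.

Lemma relabel_config1 n (B : config n) : relabel_config B 1 = B.
Proof.
case: B => [[r U] W]; congr (_, _, _).
- by apply/ffunP=> x; rewrite ffunE invg1 !perm1.
- by apply/setP=> x; rewrite -[x in LHS](perm1 x) (mem_imset _ _ perm_inj).
by apply/setP=> x; rewrite -[x in LHS](perm1 x) (mem_imset _ _ perm_inj).
Qed.

Lemma relabel_configM n (B : config n) (s t : {perm 'I_n}) :
  relabel_config B (s * t)%g = relabel_config (relabel_config B s) t.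
Proof.
case: B => [[r U] W]; congr (_, _, _).
- by apply/ffunP=> x; rewrite !ffunE /= invMg !permM.
- by rewrite -imset_comp; apply: eq_imset => x; rewrite /= permM.
by rewrite -imset_comp; apply: eq_imset => x; rewrite /= permM.
Qed.

Lemma fixesP n (s : {perm 'I_n}) (r : {ffun 'I_n -> 'I_n}) (U W : {set 'I_n}) :
  reflect [/\ forall x, r (s x) = s (r x), s @: U = U & s @: W = W]
          (fixes s (r, U, W)).
Proof.
apply: (iffP eqP) => [[/ffunP E EU EW]|[E EU EW]].
  by split=> // x; rewrite -E ffunE permK.
by congr (_, _, _) => //; apply/ffunP=> x; rewrite ffunE -E permKV.
Qed.

Lemma configP n a b (r : {ffun 'I_n -> 'I_n}) (U W : {set 'I_n}) :
  reflect [/\ forall x, r (r x) = r x, [disjoint U & W],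
            {in U, forall x, #|[set y | r y == x]| = a.+2},
            {in W, forall x, #|[set y | r y == x]| = b.+2} &
            forall x, r x != x -> r x \in U :|: W]
    (is_config a b (r, U, W)).
Proof.
apply: (iffP and5P) => -[H1 H2 H3 H4 H5]; split=> //.
- by move=> x; apply/eqP; have /forallP := H1; apply.
- by move=> x xU; apply/eqP; have /forall_inP := H3; apply.
- by move=> x xU; apply/eqP; have /forall_inP := H4; apply.
- by move=> x; apply/implyP; have /forallP := H5; apply.
- by apply/forallP=> x; apply/eqP.
- by apply/forall_inP=> x xU; apply/eqP/H3.
- by apply/forall_inP=> x xU; apply/eqP/H4.
by apply/forallP=> x; apply/implyP/H5.
Qed.

Lemma fitsP n (g : graph n) (r : {ffun 'I_n -> 'I_n}) (U W : {set 'I_n}) :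
  reflect ((forall x, r x \in U -> cnbhd (adj g) x = cnbhd (adj g) (r x)) /\
           (forall x, r x \in W -> r x != x -> nbhd (adj g) x = [set r x]))
    (fits g (r, U, W)).
Proof.
apply: (iffP forallP) => [H|[H1 H2] x].
  split=> [x rU|x rW rx]; have /andP[/implyP h1 /implyP h2] := H x.
    exact/eqP/h1.
  by apply/eqP/h2; rewrite rW.
apply/andP; split; apply/implyP; first by move/H1->.
by case/andP=> rW rx; rewrite H2.
Qed.

(** * Twins, leaves and automorphisms of a simple graph *)

Section SimpleGraph.
Variables (n : nat) (g : graph n).
Notation e := (adj g).
Hypothesis esimple : simple_graph e.
Hypothesis nal : no_adjacent_leaves e setT.
Implicit Types (x y z u v w l : 'I_n) (s t k : {perm 'I_n}).

Let adjxx := simple_irr esimple.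
Let adjC := simple_sym esimple.

Lemma in_nbhd x y : (y \in nbhd e x) = e x y.
Proof. by rewrite inE. Qed.

Lemma in_cnbhd x y : (y \in cnbhd e x) = (y == x) || e x y.
Proof. by rewrite !inE. Qed.

Lemma leafP x : reflect (exists y, nbhd e x = [set y]) (is_leaf e x).
Proof. exact: cards1P. Qed.

Lemma leaf_nbr x y : is_leaf e x -> e x y -> nbhd e x = [set y].
Proof. by case/leafP=> z E; have := in_nbhd x y; rewrite E inE => <- /eqP ->. Qed.

Lemma adjacent_leaves x y : e x y -> is_leaf e x -> ~~ is_leaf e y.
Proof.
move=> exy lx; apply/negP=> ly; have eyx : e y x by rewrite adjC.
have ne : x != y by apply: contraTneq exy => ->; rewrite adjxx.
apply: (nal (in_setT x) (in_setT y)); split; rewrite // 1?eq_sym // => z _.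
  by rewrite -in_nbhd (leaf_nbr lx exy) inE => /eqP.
by rewrite -in_nbhd (leaf_nbr ly eyx) inE => /eqP.
Qed.

Lemma cnbhd_adj x y : cnbhd e x = cnbhd e y -> x != y -> e x y.
Proof.
move=> E ne; have := in_cnbhd x y; rewrite E in_cnbhd eqxx eq_sym.
by rewrite (negbTE ne).
Qed.

(** A leaf with a sibling would form with it a pair of adjacent leaves. *)
Lemma sib_not_leaf x y : cnbhd e x = cnbhd e y -> x != y -> ~~ is_leaf e x.
Proof.
move=> E ne; apply/negP=> lx; have exy := cnbhd_adj E ne.
case/negP: (adjacent_leaves exy lx); apply/leafP; exists x; apply/setP=> z.
rewrite in_nbhd inE; apply/idP/eqP => [eyz|->]; last by rewrite adjC.
have : z \in cnbhd e x by rewrite E in_cnbhd eyz orbT.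
rewrite in_cnbhd => /orP[/eqP//|]; rewrite -in_nbhd (leaf_nbr lx exy) inE => /eqP zy.
by rewrite zy adjxx in eyz.
Qed.

Lemma support_not_leaf l w : nbhd e l = [set w] -> ~~ is_leaf e w.
Proof.
move=> E; apply: (@adjacent_leaves l); last by apply/leafP; exists w.
by rewrite -in_nbhd E inE.
Qed.

(** A sibling of a support would be the leaf itself or a second neighbor of it. Hence blobs of the
    two kinds never share a center. *)
Lemma support_no_sib l w w' : nbhd e l = [set w] -> cnbhd e w = cnbhd e w' -> w' = w.
Proof.
move=> El E; apply/eqP; apply/negPn/negP=> ne.
have ewl : e w l by rewrite adjC -in_nbhd El inE.
have : l \in cnbhd e w' by rewrite -E in_cnbhd ewl orbT.
rewrite in_cnbhd => /orP[/eqP lw'|ew'l].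
  have := sib_not_leaf (esym E) ne; rewrite -lw' => /leafP; apply; by exists w.
by move: ne; rewrite adjC -in_nbhd El inE in ew'l; rewrite ew'l.
Qed.

(** Replacing the ends of an edge by twins, one after the other, keeps it an edge; by finiteness a
    permutation that preserves edges also reflects them. *)
Lemma twin_automorphism k :
  (forall x, cnbhd e (k x) = cnbhd e x \/ nbhd e (k x) = nbhd e x) ->
  k \in automorphisms g.
Proof.
move=> tw; have tw1 x y : x != y -> e x y -> e (k x) (k y).
  move=> ne exy; have kne : k x != k y by rewrite (inj_eq perm_inj).
  have: (y == k x) || e (k x) y.
    case: (tw x) => E; first by rewrite -in_cnbhd E in_cnbhd exy orbT.
    by rewrite -in_nbhd E in_nbhd exy orbT.
  (* The exceptional case is [y = k x], where moving the first end lands on the second. *)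
  case/orP=> [/eqP yk|ekxy].
    subst y; rewrite adjC; case: (tw (k x)) => E.
      have := in_cnbhd (k (k x)) (k x); rewrite E in_cnbhd eqxx.
      by rewrite (negbTE kne) => /esym.
    case: (tw x) => E'; last first.
      by have := in_nbhd (k x) (k x); rewrite {1}E' in_nbhd adjxx exy.
    have : k (k x) \in cnbhd e x.
      by rewrite in_cnbhd adjC -in_nbhd E in_nbhd adjC exy orbT.
    rewrite -E' in_cnbhd eq_sym (negbTE kne) /=.
    by rewrite adjC.
  case: (tw y) => E; last by rewrite adjC -in_nbhd E in_nbhd adjC.
  have : k x \in cnbhd e (k y) by rewrite E in_cnbhd adjC ekxy orbT.
  by rewrite in_cnbhd (negbTE kne) /= adjC.
pose P := [set xy : 'I_n * 'I_n | g xy].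
pose kk (xy : 'I_n * 'I_n) := (k xy.1, k xy.2).
have kinj : injective kk by move=> [x y] [x' y']; case=> /perm_inj /= -> /perm_inj /= ->.
have /eqP kP : kk @: P == P.
  rewrite eqEcard card_imset // leqnn andbT; apply/subsetP=> _ /imsetP[[x y] xyP ->].
  rewrite !inE /= in xyP *; apply: (tw1 x y) => //.
  by apply: contraTneq xyP => ->; rewrite -[g _]/(e y y) adjxx.
apply/automorphismsP=> x y.
by have := mem_imset P (x, y) kinj; rewrite kP !inE.
Qed.

Lemma aut_adj s x y : s \in automorphisms g -> e (s x) (s y) = e x y.
Proof. by move/automorphismsP; apply. Qed.

Lemma aut_nbhd s x : s \in automorphisms g -> nbhd e (s x) = s @: nbhd e x.
Proof.
move=> sA; apply/setP=> y; rewrite -[y](permKV s) (mem_imset _ _ perm_inj).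
by rewrite !in_nbhd aut_adj.
Qed.

Lemma aut_cnbhd s x : s \in automorphisms g -> cnbhd e (s x) = s @: cnbhd e x.
Proof. by move=> sA; rewrite /cnbhd imsetU1 aut_nbhd. Qed.

Lemma aut_leaf s x : s \in automorphisms g -> is_leaf e (s x) = is_leaf e x.
Proof. by move=> sA; rewrite /is_leaf aut_nbhd // card_imset //; apply: perm_inj. Qed.

(** Names the class within which a vertex can be permuted freely: leaves with a common support, or
    siblings. *)
Definition key x := if is_leaf e x then nbhd e x else cnbhd e x.

Lemma key_automorphism k :
    (forall x, is_leaf e (k x) = is_leaf e x /\ key (k x) = key x) ->
  k \in automorphisms g.
Proof.
move=> H; apply: twin_automorphism => x; have [] := H x; rewrite /key => ->.
by case: ifP; [right|left].
Qed.

Section FixedSizes.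
Variables a b : nat.

Section Config.
Variables (r : {ffun 'I_n -> 'I_n}) (U W : {set 'I_n}).
Hypotheses (cB : is_config a b (r, U, W)) (fB : fits g (r, U, W)).

Lemma config_idem x : r (r x) = r x.
Proof. by case/configP: cB. Qed.

Lemma config_disj x : x \in U -> x \in W -> False.
Proof. by case/configP: cB => _ /pred0P/(_ x) /= E _ _ _ xU xW; rewrite xU xW in E. Qed.

Lemma config_moved x : r x != x -> (r x \in U) || (r x \in W).
Proof. by case/configP: cB => _ _ _ _ H /H; rewrite inE. Qed.

Lemma config_fixU u : u \in U -> r u = u.
Proof.
case/configP: (cB) => _ _ H _ _ /H E.
have : 0 < #|[set y | r y == u]| by rewrite E.
by case/card_gt0P=> y; rewrite inE => /eqP <-; rewrite config_idem.
Qed.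

Lemma config_fixW u : u \in W -> r u = u.
Proof.
case/configP: (cB) => _ _ _ H _ /H E.
have : 0 < #|[set y | r y == u]| by rewrite E.
by case/card_gt0P=> y; rewrite inE => /eqP <-; rewrite config_idem.
Qed.

Lemma card_moved_fibreU u : u \in U -> #|[set x | r x == u & r x != x]| = a.+1.
Proof.
move=> uU; case/configP: (cB) => _ _ /(_ u uU) E _ _.
rewrite (cardsD1 u) inE config_fixU // eqxx add1n in E; case: E => <-.
apply: eq_card=> x; rewrite !inE andbC [x == u]eq_sym.
by apply: andb_id2r => /eqP ->.
Qed.

Lemma card_moved_fibreW u : u \in W -> #|[set x | r x == u & r x != x]| = b.+1.
Proof.
move=> uU; case/configP: (cB) => _ _ _ /(_ u uU) E _.
rewrite (cardsD1 u) inE config_fixW // eqxx add1n in E; case: E => <-.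
apply: eq_card=> x; rewrite !inE andbC [x == u]eq_sym.
by apply: andb_id2r => /eqP ->.
Qed.

Lemma fits_cnbhd x : r x \in U -> cnbhd e x = cnbhd e (r x).
Proof. by case/fitsP: fB => H _; apply: H. Qed.

Lemma fits_nbhd x : r x \in W -> r x != x -> nbhd e x = [set r x].
Proof. by case/fitsP: fB => _; apply. Qed.

Lemma member_leaf x : r x \in W -> r x != x -> is_leaf e x.
Proof. by move=> rW rx; apply/leafP; exists (r x); exact: fits_nbhd. Qed.

Lemma supp_member w : w \in W -> exists2 l, nbhd e l = [set w] & r l = w /\ r l != l.
Proof.
move=> wW; have : 0 < #|[set x | r x == w & r x != x]| by rewrite card_moved_fibreW.
case/card_gt0P=> l; rewrite inE => /andP[/eqP rl ne]; subst w; exists l => //.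
exact: fits_nbhd.
Qed.

Lemma sib_member u : u \in U -> exists2 x, r x = u & x != u.
Proof.
move=> uU; have : 0 < #|[set x | r x == u & r x != x]| by rewrite card_moved_fibreU.
by case/card_gt0P=> x; rewrite inE => /andP[/eqP rx]; rewrite rx eq_sym; exists x.
Qed.

Lemma center_not_leaf u : u \in U -> ~~ is_leaf e u.
Proof.
move=> uU; have [x rx xu] := sib_member uU.
apply: (@sib_not_leaf u x); last by rewrite eq_sym.
by rewrite (@fits_cnbhd x) rx.
Qed.

Lemma fibre_not_leaf x : r x \in U -> ~~ is_leaf e x.
Proof.
move=> rU; have [E|ne] := eqVneq x (r x); first by rewrite E center_not_leaf.
exact: sib_not_leaf (fits_cnbhd rU) ne.
Qed.

Lemma center_cnbhd_gt1 u : u \in U -> 1 < #|cnbhd e u|.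
Proof.
move=> uU; have [x rx xu] := sib_member uU.
have E : cnbhd e x = cnbhd e u by rewrite fits_cnbhd rx.
have sub : [set x; u] \subset cnbhd e u.
  by apply/subsetP=> z; rewrite !inE => /orP[/eqP ->|->//]; rewrite -in_cnbhd -E in_cnbhd eqxx.
by have := subset_leq_card sub; rewrite cards2 xu.
Qed.

(* Two blobs with sibling centres are exchanged by an automorphism which acts
   on the set of centres as a transposition. *)
Lemma sum_not_distinct : ~~ distinct g (r, U, W) ->
  (\sum_(s in automorphisms g | fixes s (r, U, W))
     cycle_sign s (centers (r, U, W)) = 0)%R.
Proof.
rewrite negb_forall_in => /exists_inP[/= u1 u1U].
rewrite negb_forall_in => /exists_inP[/= u2 u2U].
rewrite negb_imply => /andP[/eqP eqN ne].
pose t := tperm u1 u2.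
(* [F] records the fiber of a point and whether it is the center, [F'] the same with the two fibers
   exchanged; both fibers have [a + 2] points, so a permutation [k] matches the two. *)
pose F x := (r x, x == r x); pose F' x := (t (r x), x == r x).
have fibU u i : u \in U -> #|[set x | (r x, x == r x) == (u, i)]| = if i then 1 else a.+1.
  move=> uU; case: i; last first.
    rewrite -(card_moved_fibreU uU); apply: eq_card => x.
    by rewrite !inE xpair_eqE eqbF_neg [x == _]eq_sym.
  rewrite -(cards1 u); apply: eq_card => x; rewrite !inE xpair_eqE eqb_id.
  by apply/andP/eqP => [[/eqP <- /eqP]|->] //; rewrite config_fixU ?eqxx.
have [k kE] : exists k : {perm 'I_n}, forall x, F' (k x) = F x.
  apply: perm_of_fibres => -[v i].
  have -> : #|[set x | F' x == (v, i)]| = #|[set x | (r x, x == r x) == (t v, i)]|.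
    apply: eq_card => x; rewrite !inE !xpair_eqE; congr (_ && _).
    by rewrite -(inj_eq (@perm_inj _ t)) tpermK.
  rewrite /F /t; case: tpermP => [->|->|//]; by rewrite !fibU.
have rk x : r (k x) = t (r x).
  by have [<- _] := kE x; rewrite tpermK.
have kc c : r c = c -> k c = t c.
  by move=> rc; have [_] := kE c; rewrite rk rc eqxx => /eqP.
have tU u : u \in U -> t u \in U by rewrite /t; case: tpermP.
have tW w : w \in W -> t w = w.
  by move=> wW; rewrite /t tpermD //; apply/negP=> /eqP E; apply: (@config_disj w);
     rewrite // -E.
have tN u : cnbhd e (t u) = cnbhd e u by rewrite /t; case: tpermP => // ->.
have kA : k \in automorphisms g.
  apply: twin_automorphism => x.
  have [rx|rx] := eqVneq (r x) x; first by left; rewrite kc.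
  case/orP: (config_moved rx) => [rU|rW].
    by left; rewrite fits_cnbhd rk ?tU // tN -fits_cnbhd.
  right; rewrite (fits_nbhd rW rx) fits_nbhd rk tW //.
  by apply: contra rx => /eqP E; have [_] := kE x; rewrite rk tW // E eqxx eq_sym => <-.
have kfix : fixes k (r, U, W).
  apply/fixesP; split; first by move=> x; rewrite rk kc // config_idem.
    by apply/imset_perm_stable=> u uU; rewrite kc ?tU ?config_fixU.
  by apply/imset_perm_stable=> w wW; rewrite kc ?tW ?config_fixW.
have fixst s : fixes s (r, U, W) -> {in centers (r, U, W), forall x, s x \in centers (r, U, W)}.
  case/fixesP=> _ /imset_perm_stable sU /imset_perm_stable sW x.
  by rewrite !inE => /orP[/sU ->//|/sW ->]; rewrite orbT.
have odd_k : restr_perm (centers (r, U, W)) k = true :> bool.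
  apply: (restr_perm_tperm (x := u1) (y := u2)); rewrite ?inE ?u1U ?u2U //.
  by move=> c; rewrite inE => /orP[/config_fixU|/config_fixW] /kc.
(* Translation by [k] preserves the range of summation and reverses every sign, so the sum is its
   own negative. *)
set S := (LHS); suff /eqP : S = (- S)%R by rewrite -addr_eq0 -mulr2n mulrn_eq0 => /eqP.
rewrite {1}/S (reindex_inj (mulIg k)) /= -sumrN; apply: eq_big => s.
  rewrite groupMr // /fixes relabel_configM; congr (_ && _).
  apply/eqP/eqP => [E|->]; last exact/eqP.
  by rewrite -[LHS]relabel_config1 -(mulgV k) relabel_configM E -{1}(eqP kfix)
    -relabel_configM mulgV relabel_config1.
case/andP=> _; rewrite /fixes relabel_configM => /eqP E.
have sfix : fixes s (r, U, W).
  apply/eqP; rewrite -[LHS]relabel_config1 -(mulgV k) relabel_configM E -{1}(eqP kfix).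
  by rewrite -relabel_configM mulgV relabel_config1.
by rewrite cycle_signM ?odd_k ?mulrN1 //; apply: fixst.
Qed.

End Config.

(** * Configurations sorted by their blocks *)

Definition leaves_at w := [set u | e w u & is_leaf e u].

(** A class of siblings is named by its common closed neighborhood, a tuft by the singleton of its
    support. The closed neighborhoods occurring here have at least two elements, so size tells the
    kinds apart. *)
Definition big_blocks : {set {set 'I_n}} :=
  [set cnbhd e u | u in [set u | a.+1 < #|[set v | cnbhd e v == cnbhd e u]|]]
  :|: [set [set w] | w in [set w | b < #|leaves_at w|]].

Definition blocks (B : config n) : {set {set 'I_n}} :=
  [set cnbhd e u | u in B.1.2] :|: [set [set w] | w in B.2].

Definition dconfigs : {set config n} :=
  [set B | [&& is_config a b B, fits g B & distinct g B]].

Lemma relabel_is_config (B : config n) s :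
  is_config a b B -> is_config a b (relabel_config B s).
Proof.
case: B => [[r U] W] /configP[H1 H2 H3 H4 H5].
have fib u : #|[set y | [ffun x => s (r ((s^-1)%g x))] y == s u]| = #|[set y | r y == u]|.
  rewrite -[RHS](card_imset _ (@perm_inj _ s)); apply: eq_card => y.
  rewrite -[y in RHS](permKV s) (mem_imset _ _ perm_inj) !inE ffunE.
  by rewrite (inj_eq perm_inj).
apply/configP; split.
- by move=> x; rewrite !ffunE permK H1.
- rewrite -setI_eq0 -imsetI; last by move=> x y _ _; apply: perm_inj.
  by rewrite (disjoint_setI0 H2) imset0.
- by move=> _ /imsetP[x xU ->]; rewrite fib H3.
- by move=> _ /imsetP[x xU ->]; rewrite fib H4.
move=> x; rewrite !ffunE -imsetU (mem_imset _ _ perm_inj) => ne; apply: H5.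
by apply: contra ne => /eqP ->; rewrite permKV.
Qed.

Lemma relabel_dconfigs : {in dconfigs & automorphisms g, forall B s,
  relabel_config B s \in dconfigs}.
Proof.
move=> [[r U] W] s; rewrite inE => /and3P[cB fB dB] sA; rewrite inE.
apply/and3P; split; first exact: relabel_is_config.
  case/fitsP: fB => H1 H2; apply/fitsP; split=> x; rewrite ffunE.
    rewrite (mem_imset _ _ perm_inj) => /H1 E.
    by rewrite -{1}[x](permKV s) !(aut_cnbhd _ sA) E.
  rewrite (mem_imset _ _ perm_inj) => /H2 E ne.
  rewrite -{1}[x](permKV s) (aut_nbhd _ sA) E ?imset_set1 //.
  by apply: contra ne => /eqP ->; rewrite permKV.
apply/forall_inP=> /= _ /imsetP[u uU ->]; apply/forall_inP=> /= _ /imsetP[v vU ->].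
rewrite !(aut_cnbhd _ sA) (inj_eq (imset_inj perm_inj)) (inj_eq perm_inj).
by have /forall_inP/(_ u uU)/forall_inP/(_ v vU) := dB.
Qed.

Lemma blocks_relabel : {in dconfigs & automorphisms g, forall B s,
  blocks (relabel_config B s) = set_perm s @: blocks B}.
Proof.
move=> [[r U] W] s _ sA; rewrite /blocks /= imsetU -!imset_comp; congr (_ :|: _).
  by apply: eq_imset => u; rewrite /= set_permE aut_cnbhd.
by apply: eq_imset => u; rewrite /= set_permE imset_set1.
Qed.

Section DistinctConfig.
Variables (r : {ffun 'I_n -> 'I_n}) (U W : {set 'I_n}).
Hypothesis BD : (r, U, W) \in dconfigs.

Let cB : is_config a b (r, U, W). Proof. by move: BD; rewrite inE => /and3P[]. Qed.
Let fB : fits g (r, U, W). Proof. by move: BD; rewrite inE => /and3P[]. Qed.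

Lemma cnbhd_inj_centers : {in U &, injective (cnbhd e)}.
Proof.
move=> u v uU vU E; move: BD; rewrite inE => /and3P[_ _ /forall_inP/(_ u uU)].
by move=> /forall_inP/(_ v vU)/implyP; rewrite E eqxx => /(_ isT)/eqP.
Qed.

Lemma cnbhd_centersE kk :
  (kk \in [set cnbhd e u | u in U]) = (kk \in blocks (r, U, W)) && (1 < #|kk|).
Proof.
rewrite inE /=; apply/idP/andP => [kU|[/orP[//|/imsetP[w _ ->]]]].
  rewrite kU; split=> //; case/imsetP: kU => u uU ->; exact: center_cnbhd_gt1 cB fB _ uU.
by rewrite cards1.
Qed.

Lemma supportsE w : (w \in W) = ([set w] \in blocks (r, U, W)).
Proof.
have : [set w] \notin [set cnbhd e u | u in U].
  by rewrite cnbhd_centersE cards1 andbF.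
by rewrite inE /= => /negbTE ->; rewrite (mem_imset _ _ set1_inj).
Qed.

Lemma blocks_sub : blocks (r, U, W) \subset big_blocks.
Proof.
apply/subsetP=> k; rewrite !inE /= => /orP[] /imsetP[u uU ->]; apply/orP.
  left; apply: imset_f; rewrite inE; have /configP[_ _ /(_ u uU) E _ _] := cB.
  rewrite -E; apply: subset_leq_card; apply/subsetP=> x; rewrite !inE => /eqP rx.
  by rewrite (fits_cnbhd fB) rx.
right; apply: imset_f; rewrite inE -ltnS -[b.+1](card_moved_fibreW cB uU) ltnS.
apply: subset_leq_card; apply/subsetP=> x; rewrite !inE => /andP[/eqP rx ne].
subst u; rewrite (member_leaf fB uU ne) andbT simple_sym // -in_nbhd.
by rewrite (fits_nbhd fB uU ne) inE.
Qed.

(** Invariants of a point relative to a configuration; the counts that follow show that the sizes of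
    their fibers depend only on the blocks. *)
Definition label x := (is_leaf e x, key x, x \in U, r x != x).

Definition label_count (ll : bool) (kk : {set 'I_n}) (i j : bool) :=
  #|[set x | label x == (ll, kk, i, j)]|.

Lemma label_count_moved_center ll kk : label_count ll kk true true = 0.
Proof.
apply/eqP; rewrite cards_eq0 -subset0; apply/subsetP=> x; rewrite inE !xpair_eqE.
rewrite !eqb_id => /andP[/andP[_ xU]]; by rewrite (config_fixU cB xU) eqxx.
Qed.

Lemma label_count_center ll kk : label_count ll kk true false =
  (~~ ll && (kk \in [set cnbhd e u | u in U])).
Proof.
have -> : label_count ll kk true false = #|[set x in U | ~~ ll && (cnbhd e x == kk)]|.
  apply: eq_card => x; rewrite !inE !xpair_eqE !eqb_id eqbF_neg negbK.
  case: (boolP (x \in U)) => xU; last by rewrite andbF.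
  rewrite (config_fixU cB xU) eqxx !andbT /key (negbTE (center_not_leaf cB fB xU)).
  by rewrite eq_sym eqbF_neg.
case: ll => /=; first by apply: eq_card0 => x; rewrite inE andbF.
case: imsetP => [[u uU ->]|nk] /=.
  rewrite -(cards1 u); apply: eq_card => x; rewrite !inE.
  apply/andP/eqP => [[xU /eqP/(cnbhd_inj_centers xU uU)] //|->].
  by rewrite uU eqxx.
apply: eq_card0 => x; rewrite inE; apply/negbTE/andP => -[xU /eqP E].
by apply: nk; exists x.
Qed.

Lemma label_count_member ll kk : label_count ll kk false true =
  if ll then b.+1 * (kk \in [set [set w] | w in W])
  else a.+1 * (kk \in [set cnbhd e u | u in U]).
Proof.
have nU x : r x != x -> x \in U = false.
  by apply: contraNF => xU; rewrite (config_fixU cB xU).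
case: ll; case: imsetP => [[u uU ->]|nk]; rewrite ?muln1 ?muln0.
- rewrite -(card_moved_fibreW cB uU); apply: eq_card => x.
  rewrite !inE !xpair_eqE !eqb_id eqbF_neg.
  have [rx|rx] := eqVneq (r x) x; first by rewrite !andbF.
  rewrite nU //= !andbT /key; apply/andP/eqP => [[lx]|rxu].
    rewrite lx; case/orP: (config_moved cB rx) => rW.
      by have := fibre_not_leaf cB fB rW; rewrite lx.
    by rewrite (fits_nbhd fB rW rx) => /eqP/set1_inj.
  have rW : r x \in W by rewrite rxu.
  by rewrite (member_leaf fB rW rx) (fits_nbhd fB rW rx) rxu.
- apply: eq_card0 => x; rewrite inE !xpair_eqE !eqb_id eqbF_neg; apply/negbTE.
  apply/negP=> /andP[/andP[/andP[lx /eqP kx] _] rx]; apply: nk.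
  exists (r x); case/orP: (config_moved cB rx) => rW //.
  - by have := fibre_not_leaf cB fB rW; rewrite lx.
  - by have := fibre_not_leaf cB fB rW; rewrite lx.
  by rewrite -kx /key lx (fits_nbhd fB rW rx).
- rewrite -(card_moved_fibreU cB uU); apply: eq_card => x.
  rewrite !inE !xpair_eqE !eqb_id !eqbF_neg.
  have [rx|rx] := eqVneq (r x) x; first by rewrite !andbF.
  rewrite nU //= !andbT /key; apply/andP/eqP => [[lx]|rxu].
    rewrite (negbTE lx); case/orP: (config_moved cB rx) => rU.
      by rewrite (fits_cnbhd fB rU) => /eqP/(cnbhd_inj_centers rU uU).
    by have := member_leaf fB rU rx; rewrite (negbTE lx).
  have rU : r x \in U by rewrite rxu.
  have lx := fibre_not_leaf cB fB rU.
  by rewrite lx (negbTE lx) (fits_cnbhd fB rU) rxu.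
apply: eq_card0 => x; rewrite inE !xpair_eqE !eqb_id !eqbF_neg; apply/negbTE.
apply/negP=> /andP[/andP[/andP[lx /eqP kx] _] rx]; apply: nk.
exists (r x); case/orP: (config_moved cB rx) => rU //.
- by have := member_leaf fB rU rx; rewrite (negbTE lx).
- by rewrite -kx /key (negbTE lx) (fits_cnbhd fB rU).
by have := member_leaf fB rU rx; rewrite (negbTE lx).
Qed.

(** The two last flags split the points of a given key into four sets, one of them empty, so the
    last count follows by subtraction. *)
Lemma label_count_rest ll kk : label_count ll kk false false =
  #|[set x | (is_leaf e x, key x) == (ll, kk)]| - label_count ll kk true false
    - label_count ll kk false true.
Proof.
pose A i j := [set x | label x == (ll, kk, i, j)].
set C := [set x | _ == (ll, kk)].
have CE i j : C :&: [set x | (x \in U) == i] :&: [set x | (r x != x) == j] = A i j.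
  by apply/setP=> x; rewrite !inE -!xpair_eqE.
rewrite -(cardsID [set x | (x \in U) == true] C).
rewrite -(cardsID [set x | (r x != x) == true] (C :\: _)).
have -> : C :\: [set x | (x \in U) == true] = C :&: [set x | (x \in U) == false].
  by apply/setP=> x; rewrite !inE andbC; case: (x \in U).
have -> : C :&: [set x | (x \in U) == false] :\: [set x | (r x != x) == true]
   = A false false.
  by rewrite -CE; apply/setP=> x; rewrite !inE andbC; case: (r x == x).
rewrite CE -(cardsID [set x | (r x != x) == true] (C :&: [set x | (x \in U) == true])).
have -> : C :&: [set x | (x \in U) == true] :\: [set x | (r x != x) == true]
   = A true false.
  by rewrite -CE; apply/setP=> x; rewrite !inE andbC; case: (r x == x).
rewrite CE -/(label_count ll kk true true) label_count_moved_center add0n.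
by rewrite addKn addKn.
Qed.

End DistinctConfig.

(** Equal blocks give equal label counts, hence a permutation carrying the labels of [B] to those of
    [B']. It preserves [key], so it is an automorphism and fixes every block; as the key of a moved
    point determines its center, it sends [B] to [B']. *)
Lemma dconfigs_transitive : {in dconfigs &, forall B B', blocks B = blocks B' ->
  exists2 k, k \in automorphisms g &
    relabel_config B k = B' /\ {in blocks B, forall c, set_perm k c = c}}.
Proof.
move=> [[r U] W] [[r' U'] W'] BD BD' EB.
have /and3P[cB fB _] : [&& is_config a b (r, U, W), fits g (r, U, W) &
  distinct g (r, U, W)] by move: BD; rewrite inE.
have /and3P[cB' fB' _] : [&& is_config a b (r', U', W'), fits g (r', U', W') &
  distinct g (r', U', W')] by move: BD'; rewrite inE.
have EU kk : (kk \in [set cnbhd e u | u in U]) = (kk \in [set cnbhd e u | u in U']).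
  by rewrite (cnbhd_centersE BD) (cnbhd_centersE BD') EB.
have EW : W = W' by apply/setP=> w; rewrite (supportsE BD) (supportsE BD') EB.
have [k kE] : exists k : {perm 'I_n}, forall x, label r' U' (k x) = label r U x.
  apply: perm_of_fibres => -[[[ll kk] i] j].
  suff : label_count r U ll kk i j = label_count r' U' ll kk i j by [].
  case: i; case: j.
  - by rewrite !(label_count_moved_center BD, label_count_moved_center BD').
  - by rewrite (label_count_center BD) (label_count_center BD') EU.
  - by rewrite (label_count_member BD) (label_count_member BD') EU EW.
  rewrite (label_count_rest BD) (label_count_rest BD').
  rewrite (label_count_center BD) (label_count_center BD').
  by rewrite (label_count_member BD) (label_count_member BD') EU EW.
have lk x : is_leaf e (k x) = is_leaf e x by case: (kE x).
have keyk x : key (k x) = key x by case: (kE x).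
have Uk x : (k x \in U') = (x \in U) by case: (kE x).
have rk x : (r' (k x) != k x) = (r x != x) by case: (kE x).
have kA : k \in automorphisms g by apply: key_automorphism => x.
have cnk x : ~~ is_leaf e x -> cnbhd e (k x) = cnbhd e x.
  by move=> lx; have := keyk x; rewrite /key lk (negbTE lx).
have nk x : is_leaf e x -> nbhd e (k x) = nbhd e x.
  by move=> lx; have := keyk x; rewrite /key lk lx.
have kW w : w \in W -> k w = w.
  move=> wW; have [l El [rl ne]] := supp_member cB fB wW.
  have ll : is_leaf e l by apply/leafP; exists w.
  by have := nk l ll; rewrite aut_nbhd // El imset_set1 => /set1_inj.
exists k => //; split; last first.
  move=> c; rewrite inE => /orP[] /imsetP[/= u uU ->]; rewrite set_permE.
    by rewrite -aut_cnbhd // cnk // (center_not_leaf cB fB uU).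
  by rewrite imset_set1 kW.
congr (_, _, _).
- apply/ffunP=> y; rewrite ffunE -[y in RHS](permKV k).
  set x := (k^-1)%g y; have [rx|rx] := eqVneq (r x) x.
    by have := rk x; rewrite rx eqxx => /negbT; rewrite negbK => /eqP.
  have rx' : r' (k x) != k x by rewrite rk.
  case/orP: (config_moved cB rx) => rU.
    have lx := fibre_not_leaf cB fB rU.
    have rU' : r' (k x) \in U'.
      case/orP: (config_moved cB' rx') => // rW'.
      by have := member_leaf fB' rW' rx'; rewrite lk (negbTE lx).
    apply: (cnbhd_inj_centers BD') => //; first by rewrite Uk.
    by rewrite -(fits_cnbhd fB' rU') !cnk ?(center_not_leaf cB fB rU) // (fits_cnbhd fB rU).
  have lx := member_leaf fB rU rx.
  have rW' : r' (k x) \in W'.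
    case/orP: (config_moved cB' rx') => // rU'.
    by have := fibre_not_leaf cB' fB' rU'; rewrite lk lx.
  rewrite kW //; apply: set1_inj.
  by rewrite -(fits_nbhd fB' rW' rx') nk // (fits_nbhd fB rU rx).
- apply/setP=> y; rewrite -[y](permKV k) (mem_imset _ _ perm_inj).
  by rewrite Uk.
by rewrite -EW; apply/imset_perm_stable => w wW; rewrite kW.
Qed.

Lemma subset_of_card (T : finType) (A : {set T}) m : m <= #|A| ->
  exists2 L : {set T}, L \subset A & #|L| = m.
Proof.
move=> mA; exists [set x in take m (enum A)].
  by apply/subsetP=> x; rewrite inE => /mem_take; rewrite mem_enum.
rewrite cardsE (card_uniqP _) ?take_uniq ?enum_uniq //.
by rewrite size_takel // -cardE.
Qed.

Lemma big_block_blob kk : kk \in big_blocks -> exists cL : 'I_n * {set 'I_n},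
  cL.1 \notin cL.2 /\
  ([/\ kk = cnbhd e cL.1, #|cL.2| = a.+1 & forall x, x \in cL.2 -> cnbhd e x = kk] \/
   [/\ kk = [set cL.1], #|cL.2| = b.+1 & forall x, x \in cL.2 -> nbhd e x = kk]).
Proof.
rewrite inE => /orP[] /imsetP[u]; rewrite inE => uP ->.
  have [|L sub cL] := @subset_of_card _ ([set v | cnbhd e v == cnbhd e u] :\ u) a.+1.
    by move: uP; rewrite (cardsD1 u) inE eqxx.
  exists (u, L) => /=; split; first by apply/negP=> /(subsetP sub); rewrite !inE eqxx.
  left; split=> // x /(subsetP sub); rewrite !inE; by case/andP=> _ /eqP.
have [L sub cL] := subset_of_card uP.
have LP x : x \in L -> nbhd e x = [set u].
  move/(subsetP sub); rewrite inE => /andP[eux lx]; apply: leaf_nbr => //.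
  by rewrite adjC.
exists (u, L) => /=; split; last by right.
by apply/negP=> /LP E; have := in_nbhd u u; rewrite E inE eqxx adjxx.
Qed.

(** One blob is chosen in each block of [X]. Members of different blobs have different keys, and a
    support is neither a leaf nor has siblings; so the blobs are disjoint and assemble into one
    retraction. *)
Lemma dconfigs_surj (X : {set {set 'I_n}}) : 0 < n -> X \subset big_blocks ->
  exists2 B, B \in dconfigs & blocks B = X.
Proof.
move=> n0 XO.
pose P kk (p : 'I_n * {set 'I_n}) := kk \in X -> p.1 \notin p.2 /\
  ([/\ kk = cnbhd e p.1, #|p.2| = a.+1 & forall x, x \in p.2 -> cnbhd e x = kk] \/
   [/\ kk = [set p.1], #|p.2| = b.+1 & forall x, x \in p.2 -> nbhd e x = kk]).
have [cL cLP] : exists cL, forall kk, P kk (cL kk).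
  apply: fin_all_exists.
  (* Sets outside [X] receive a default pair, which exists because [n] is positive. *)
  move=> kk; have [kX|/negP nX] := boolP (kk \in X); last by exists (Ordinal n0, set0).
  by have [p] := big_block_blob (subsetP XO _ kX); exists p.
pose c kk := (cL kk).1; pose L kk := (cL kk).2.
have cnL kk : kk \in X -> c kk \notin L kk by move=> kX; case: (cLP kk kX).
have sibP kk : kk \in X -> 1 < #|kk| ->
  [/\ kk = cnbhd e (c kk), #|L kk| = a.+1 & forall x, x \in L kk -> cnbhd e x = kk].
  move=> kX k1; have [_ [//|[E _ _]]] := cLP kk kX.
  by rewrite E cards1 in k1.
have leafP' kk : kk \in X -> #|kk| <= 1 ->
  [/\ kk = [set c kk], #|L kk| = b.+1 & forall x, x \in L kk -> nbhd e x = kk].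
  move=> kX k1; have [_ [[E1 E2 E3]|//]] := cLP kk kX.
  have [x xL] : exists x, x \in L kk by apply/card_gt0P; rewrite E2.
  have ne : x != c kk by apply: contraNneq (cnL kk kX) => <-.
  suff sub : [set x; c kk] \subset kk.
    by have := leq_trans (subset_leq_card sub) k1; rewrite cards2 ne.
  apply/subsetP=> z; rewrite !inE => /orP[] /eqP ->.
    by rewrite -(E3 x xL) in_cnbhd eqxx.
  by have := in_cnbhd (cL kk).1 (c kk); rewrite -E1 eqxx.
have Lmem kk : kk \in X -> exists x, x \in L kk.
  move=> kX; apply/card_gt0P; case: (ltnP 1 #|kk|) => k1.
    by have [_ -> _] := sibP kk kX k1.
  by have [_ -> _] := leafP' kk kX k1.
have csib kk : kk \in X -> 1 < #|kk| ->
  exists2 x, cnbhd e x = cnbhd e (c kk) & x != c kk.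
  move=> kX k1; have [E _ H] := sibP kk kX k1; have [x xL] := Lmem kk kX.
  exists x; first by rewrite H.
  by apply: contraNneq (cnL kk kX) => <-.
have clf kk : kk \in X -> #|kk| <= 1 -> exists l, nbhd e l = [set c kk].
  move=> kX k1; have [E _ H] := leafP' kk kX k1; have [x xL] := Lmem kk kX.
  by exists x; rewrite H.
have keyL kk x : kk \in X -> x \in L kk -> key x = kk.
  move=> kX xL; rewrite /key; case: (ltnP 1 #|kk|) => k1.
    have [E _ H] := sibP kk kX k1.
    suff nl : ~~ is_leaf e x by rewrite (negbTE nl) H.
    apply: (@sib_not_leaf x (c kk)); first by rewrite H.
    by apply: contraNneq (cnL kk kX) => <-.
  have [E _ H] := leafP' kk kX k1; have Ex := H x xL.
  suff -> : is_leaf e x by [].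
  by apply/leafP; exists (c kk); rewrite Ex -E.
have keyc kk : kk \in X -> 1 < #|kk| -> key (c kk) = kk.
  move=> kX k1; have [x Ex ne] := csib kk kX k1.
  have nl : ~~ is_leaf e (c kk) by apply: (sib_not_leaf (esym Ex)); rewrite eq_sym.
  by rewrite /key (negbTE nl); have [<-] := sibP kk kX k1.
have no_both kk kk' : kk \in X -> kk' \in X -> 1 < #|kk| -> #|kk'| <= 1 ->
  c kk != c kk'.
  move=> kX kX' k1 k1'; apply/eqP=> E; have [x Ex ne] := csib kk kX k1.
  have [l El] := clf kk' kX' k1'; rewrite -E in El.
  by rewrite (support_no_sib El (esym Ex)) eqxx in ne.
have cL' kk kk' : kk \in X -> kk' \in X -> c kk \notin L kk'.
  move=> kX kX'; apply/negP=> cL1; case: (ltnP 1 #|kk|) => k1.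
    have E := keyc kk kX k1; rewrite (keyL kk') // in E.
    by have := cnL kk kX; rewrite -{2}E cL1.
  have [l El] := clf kk kX k1; have nl := support_not_leaf El.
  case: (ltnP 1 #|kk'|) => k1'; last first.
    have [E _ H] := leafP' kk' kX' k1'; case/leafP: nl.
    by exists (c kk'); rewrite H.
  have [E _ H] := sibP kk' kX' k1'.
  have EE : cnbhd e (c kk) = cnbhd e (c kk') by rewrite H.
  by have := cnL kk' kX'; rewrite (support_no_sib El EE) cL1.
have cinj : {in X &, injective c}.
  move=> kk kk' kX kX' E.
  case: (ltnP 1 #|kk|) => k1; case: (ltnP 1 #|kk'|) => k1'.
  - by rewrite -(keyc kk) // -(keyc kk') // E.
  - by have := no_both kk kk' kX kX' k1 k1'; rewrite E eqxx.
  - by have := no_both kk' kk kX' kX k1' k1; rewrite E eqxx.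
  by have [-> _ _] := leafP' kk kX k1; have [-> _ _] := leafP' kk' kX' k1'; rewrite E.
(* The key of a member is its block, so its center can be found from the point alone. *)
pose r := [ffun x => if (key x \in X) && (x \in L (key x)) then c (key x) else x].
pose U := [set c kk | kk in X & 1 < #|kk|].
pose W := [set c kk | kk in X & #|kk| <= 1].
have rL kk x : kk \in X -> x \in L kk -> r x = c kk.
  by move=> kX xL; rewrite ffunE (keyL kk) // kX xL.
have rc kk : kk \in X -> r (c kk) = c kk.
  move=> kX; rewrite ffunE; case: ifP => // /andP[kX' cL1].
  by have := cL' kk _ kX kX'; rewrite cL1.
have rP x : r x = x \/ exists2 kk, kk \in X & x \in L kk /\ r x = c kk.
  rewrite ffunE; case: ifP => [/andP[kX xL]|_]; last by left.
  by right; exists (key x).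
have fib kk : kk \in X -> [set y | r y == c kk] = c kk |: L kk.
  move=> kX; apply/setP=> y; rewrite !inE; apply/eqP/orP => [E|[/eqP ->|yL]].
  - have [ry|[k2 k2X [yL ry]]] := rP y; first by left; rewrite -E ry.
    by right; rewrite -(cinj k2 kk) // -ry.
  - exact: rc.
  exact: rL.
have UX x : x \in U -> exists kk, [/\ kk \in X, 1 < #|kk| & x = c kk].
  by case/imsetP=> kk; rewrite inE => /andP[kX k1] ->; exists kk.
have WX x : x \in W -> exists kk, [/\ kk \in X, #|kk| <= 1 & x = c kk].
  by case/imsetP=> kk; rewrite inE => /andP[kX k1] ->; exists kk.
have fibE kk x : kk \in X -> r x = c kk -> x = c kk \/ x \in L kk.
  move=> kX rx; have : x \in [set y | r y == c kk] by rewrite inE rx.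
  by rewrite fib // !inE => /orP[/eqP|]; [left|right].
exists (r, U, W); last first.
  apply/setP=> kk; rewrite inE /=; apply/orP/idP => [[]|kX].
  - case/imsetP=> u /UX[k2 [k2X k21 ->]] ->.
    by have [<-] := sibP k2 k2X k21.
  - case/imsetP=> u /WX[k2 [k2X k21 ->]] ->.
    by have [<-] := leafP' k2 k2X k21.
  case: (ltnP 1 #|kk|) => k1; [left|right]; apply/imsetP; exists (c kk).
  - by apply: imset_f; rewrite inE kX.
  - by have [] := sibP kk kX k1.
  - by apply: imset_f; rewrite inE kX.
  by have [] := leafP' kk kX k1.
rewrite inE; apply/and3P; split.
- apply/configP; split.
  + by move=> x; have [E|[kk kX [xL ->]]] := rP x; [rewrite !E | exact: rc].
  + apply/pred0P=> x /=; apply/negbTE/andP=> -[/UX[kk [kX k1 ->]] /WX[k2 [k2X k21]]].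
    by apply/eqP; exact: no_both.
  + move=> x /UX[kk [kX k1 ->]]; rewrite fib // cardsU1 cnL //.
    by have [_ -> _] := sibP kk kX k1.
  + move=> x /WX[kk [kX k1 ->]]; rewrite fib // cardsU1 cnL //.
    by have [_ -> _] := leafP' kk kX k1.
  move=> x; have [->|[kk kX [xL ->]]] := rP x; first by rewrite eqxx.
  move=> _; rewrite inE; case: (ltnP 1 #|kk|) => k1; apply/orP; [left|right];
    by apply: imset_f; rewrite inE kX.
- apply/fitsP; split=> x.
    case/UX=> kk [kX k1 rx]; rewrite rx; have [E _ H] := sibP kk kX k1.
    have [->//|xL] := fibE kk x kX rx; by rewrite H.
  case/WX=> kk [kX k1 rx]; rewrite rx; have [E _ H] := leafP' kk kX k1.
  have [->|xL _] := fibE kk x kX rx; first by rewrite eqxx.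
  by rewrite H.
apply/forall_inP=> /= u /UX[kk [kX k1 ->]]; apply/forall_inP=> /= v /UX[k2 [k2X k21 ->]].
apply/implyP=> /eqP E; apply/eqP; congr c.
by have [-> _ _] := sibP kk kX k1; have [-> _ _] := sibP k2 k2X k21.
Qed.

Lemma big_blocks_aut s : s \in automorphisms g ->
  {in big_blocks, forall c, set_perm s c \in big_blocks}.
Proof.
move=> sA c; rewrite set_permE !inE => /orP[] /imsetP[u uP ->]; apply/orP.
  left; apply/imsetP; exists (s u); last by rewrite aut_cnbhd.
  rewrite !inE in uP *; apply: leq_trans uP _.
  rewrite -(card_imset _ (@perm_inj _ s)); apply: subset_leq_card.
  apply/subsetP=> _ /imsetP[x + ->]; rewrite !inE => /eqP E.
  by rewrite !aut_cnbhd // E.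
right; rewrite imset_set1; apply: imset_f.
rewrite !inE in uP *; apply: leq_trans uP _.
rewrite -(card_imset _ (@perm_inj _ s)); apply: subset_leq_card.
apply/subsetP=> _ /imsetP[x + ->]; rewrite !inE.
by rewrite aut_adj // aut_leaf.
Qed.

(** [sibling] is one less than the size of a class while [tuft] counts leaves alone, hence the
    thresholds [a + 2] and [b + 1]. *)
Lemma big_blocks_eq0 : 0 < n ->
  (big_blocks == set0) = (sibling e <= a) && (tuft e <= b).
Proof.
move=> n0; rewrite setU_eq0 !imset_eq0; congr (_ && _).
  rewrite /sibling leq_subLR add1n; apply/eqP/bigmax_leqP => [E v _|H].
    by rewrite leqNgt; apply/negP=> lt; have := in_set0 v; rewrite -E inE lt.
  by apply/setP=> v; rewrite !inE ltnNge H.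
apply/eqP/bigmax_leqP => [E v _|H].
  by rewrite leqNgt; apply/negP=> lt; have := in_set0 v; rewrite -E inE lt.
by apply/setP=> v; rewrite !inE ltnNge H.
Qed.

Lemma config_sum : 0 < n ->
  (\sum_(s in automorphisms g)
     \sum_(B : config n | [&& is_config a b B, fits g B & fixes s B])
       cycle_sign s (centers B) =
   \sum_(s in automorphisms g) ((sibling e <= a)%N && (tuft e <= b)%N)%:R)%R.
Proof.
move=> n0; rewrite -big_blocks_eq0 //.
(* Once the weight depends on the blocks alone, the sum collapses to invariant sets of big blocks,
   where toggling an orbit applies. *)
transitivity (\sum_(s in automorphisms g) \sum_(B in dconfigs | relabel_config B s == B)
   cycle_sign (set_perm s) (blocks B))%R; last first.
  rewrite (@sum_fixed_fibre _ (automorphisms_group g) _ _ (@relabel_config n)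
    (fun (Z : {set {set 'I_n}}) s => set_perm s @: Z) blocks dconfigs (powerset big_blocks)
    (fun s Z => cycle_sign (set_perm s) Z)).
  - apply: eq_bigr => s sA; apply: sum_cycle_sign; exact: big_blocks_aut.
  - exact: relabel_config1.
  - exact: relabel_configM.
  - exact: relabel_dconfigs.
  - exact: blocks_relabel.
  - apply/setP=> X; rewrite powersetE; apply/imsetP/idP => [[[[r U] W] BD ->]|XO].
      exact: blocks_sub BD.
    by have [B BD <-] := dconfigs_surj n0 XO; exists B.
  move=> B B' BD BD' EB; have [k kA [kB kfix]] := dconfigs_transitive BD BD' EB.
  exists k => //; split=> // s sA /imset_perm_stable sX.
  rewrite set_permM cycle_signM //; last by move=> c cB; rewrite kfix.
  by rewrite restr_perm_fix // expr0 mulr1.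
(* Sending a center to its block is injective and commutes with [s], so the cycles on centers and on
   blocks are equally many. *)
transitivity (\sum_(s in automorphisms g) \sum_(B in dconfigs | fixes s B)
   cycle_sign s (centers B))%R; last first.
  apply: eq_bigr => s sA; apply: eq_bigr => -[[r U] W] /andP[BD fx].
  have /and3P[cB fB _] : [&& is_config a b (r, U, W), fits g (r, U, W) &
    distinct g (r, U, W)] by move: BD; rewrite inE.
  have [_ /imset_perm_stable sU /imset_perm_stable sW] := fixesP _ _ _ _ fx.
  pose h x := if x \in U then cnbhd e x else [set x].
  have -> : blocks (r, U, W) = h @: centers (r, U, W).
    rewrite /centers /= imsetU; congr (_ :|: _); apply: eq_in_imset => x xU.
      by rewrite /h xU.
    by rewrite /h; case: ifP => // xU'; case: (config_disj cB xU').
  rewrite /cycle_sign (@cycle_sign_transport _ _ s (set_perm s) h) //.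
  - by move=> x; rewrite !inE => /orP[/sU ->//|/sW ->]; rewrite orbT.
  - move=> x; rewrite inE /h set_permE => /orP[] xU.
      by rewrite sU // xU aut_cnbhd.
    have xU' y : y \in W -> y \in U = false.
      by move=> yW; apply/negP=> yU; case: (config_disj cB yU yW).
    by rewrite !xU' ?sW // imset_set1.
  move=> x y; rewrite !inE /h => xB yB.
  have gt1 := center_cnbhd_gt1 cB fB.
  case: ifP => xU; case: ifP => yU.
  - exact: cnbhd_inj_centers BD _ _ xU yU.
  - by move=> E; have := gt1 x xU; rewrite E cards1.
  - by move=> E; have := gt1 y yU; rewrite -E cards1.
  exact: set1_inj.
rewrite (exchange_big_dep (fun B => is_config a b B && fits g B)) /=; last first.
  by move=> s B _ /and3P[-> ->].
(* For each configuration with two sibling centers the sum over [s] vanishes. *)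
rewrite (bigID (distinct g)) /= [X in (_ + X)%R]big1 ?addr0; last first.
  move=> [[r U] W] /andP[/andP[cB fB] nd].
  rewrite -[RHS](sum_not_distinct cB fB nd); apply: eq_bigl => s.
  by rewrite cB fB.
rewrite [RHS](exchange_big_dep [in dconfigs]) /=; last by move=> s B _ /andP[].
apply: eq_big => [B|B /andP[/andP[cB fB] dB]]; first by rewrite inE andbA.
by apply: eq_bigl => s; rewrite [B \in dconfigs]inE cB fB dB.
Qed.

End FixedSizes.
End SimpleGraph.

(** * Exchanging the two kinds of blobs *)

(* The graph obtained from the restriction of [h] to the centres by turning each
   centre in [U] into a group of siblings and attaching leaves to each centre in
   [W]. *)
Definition expand n (B : config n) (h : graph n) : graph n :=
  let: (r, U, W) := B in
  [ffun xy => if r xy.1 == r xy.2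
    then (xy.1 != xy.2) && [|| r xy.1 \in U, xy.1 == r xy.1 | xy.2 == r xy.2]
    else [&& h (r xy.1, r xy.2), (r xy.1 \in W) ==> (xy.1 == r xy.1)
           & (r xy.2 \in W) ==> (xy.2 == r xy.2)]].

Definition swap n (B : config n) : config n := (B.1.1, B.2, B.1.2).

Lemma swap_is_config n a b (B : config n) :
  is_config b a (swap B) = is_config a b B.
Proof.
case: B => [[r U] W]; rewrite /is_config /swap /= disjoint_sym setUC.
by congr [&& _, _ & _]; rewrite andbCA.
Qed.

Section Expand.
Variables (n a b : nat) (r : {ffun 'I_n -> 'I_n}) (U W : {set 'I_n}).
Hypothesis cB : is_config a b (r, U, W).

Let rr x : r (r x) = r x := config_idem cB x.
Let moved x : r x != x -> (r x \in U) || (r x \in W) := @config_moved _ _ _ _ _ _ cB x.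
Let UW x : x \in U -> x \in W = false.
Proof. by move=> xU; apply/negP=> xW; case: (config_disj cB xU xW). Qed.

Lemma expand_simple (h : graph n) : simple_graph (adj h) ->
  simple_graph (adj (expand (r, U, W) h)).
Proof.
move=> hs; apply/andP; split; apply/forallP=> x.
  by rewrite /adj ffunE /= !eqxx.
apply/forallP=> y; rewrite /adj !ffunE /= eq_sym [x == y]eq_sym.
case: (eqVneq (r y) (r x)) => [->|_].
  by rewrite (orbC (x == r x)).
by have := simple_sym hs (r x) (r y); rewrite /adj => ->; rewrite (andbC (_ ==> _)).
Qed.

Lemma expand_fits (h : graph n) : fits (expand (r, U, W) h) (r, U, W).
Proof.
apply/fitsP; split=> x rx.
  apply/setP=> z; rewrite !inE /adj !ffunE /= !rr rx /=.
  have [E|ne] := eqVneq (r x) (r z).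
    by rewrite !andbT !(eq_sym _ z) !orbN.
  have -> : z == x = false by apply: contraNF ne => /eqP ->.
  have -> : z == r x = false by apply: contraNF ne => /eqP ->; rewrite rr.
  by rewrite UW.
move=> ne; apply/setP=> z; rewrite !inE /adj !ffunE /=.
have rU : r x \in U = false by apply/negP=> /UW; rewrite rx.
rewrite rx rU [x == r x]eq_sym (negbTE ne) /=.
have [E|ne'] := eqVneq (r x) (r z).
  rewrite E; apply: andb_idl => /eqP zr.
  by apply: contraNneq ne => xz; rewrite {2}xz zr -E.
by rewrite andbF; apply/esym; apply: contraNF ne' => /eqP ->; rewrite rr.
Qed.

(** Expansion reads [h] only at pairs of distinct centers and leaves adjacency between them
    unchanged. *)
Lemma expand_swap (h : graph n) :
  expand (r, W, U) (expand (r, U, W) h) = expand (r, W, U) h.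
Proof.
apply/ffunP=> -[x y]; rewrite !ffunE /= !rr.
by case: (r x == r y) => //; rewrite !eqxx !implybT !andbT.
Qed.

Lemma expand_automorphism (h : graph n) s :
    fixes s (r, U, W) -> s \in automorphisms h ->
  s \in automorphisms (expand (r, U, W) h).
Proof.
case/fixesP=> rs EU EW /automorphismsP hs; apply/automorphismsP=> x y.
have sU z : (s z \in U) = (z \in U) by rewrite -{1}EU (mem_imset _ _ perm_inj).
have sW z : (s z \in W) = (z \in W) by rewrite -{1}EW (mem_imset _ _ perm_inj).
by rewrite !ffunE /= !rs !(inj_eq perm_inj) sU !sW hs.
Qed.

(** A fitting graph is determined by its restriction to the centers. Together with [expand_swap]
    this makes the exchange of kinds an involution. *)
Lemma fits_expand (g : graph n) : simple_graph (adj g) -> fits g (r, U, W) ->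
  expand (r, U, W) g = g.
Proof.
move=> gs fB; have [fU fW] := (@fits_cnbhd _ _ _ _ _ fB, @fits_nbhd _ _ _ _ _ fB).
apply/ffunP=> -[x y]; rewrite ffunE /= -[RHS]/(adj g x y).
have gC := simple_sym gs; have gI := simple_irr gs.
case: (eqVneq (r x) (r y)) => [E|ne].
  have [->|xy] := eqVneq x y; first by rewrite gI.
  have [rU|rU] /= := boolP (r x \in U).
    by apply/esym/(cnbhd_adj _ xy); rewrite (fU x) // (fU y) -E.
  have rW z : r z = r x -> r z != z -> r x \in W.
    by move=> rz /moved; rewrite rz (negbTE rU).
  have [xr|xr] := eqVneq x (r x) => /=.
    have yr : r y != y by rewrite -E -xr.
    rewrite gC -in_nbhd fW // -E ?(rW y) //.
    by rewrite -xr inE eqxx.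
  rewrite eq_sym in xr; rewrite -in_nbhd fW ?(rW x) // inE.
  by rewrite E.
(* Each end in turn is moved to the center of its fiber; a leaf over [W] has no neighbor outside its
   fiber. *)
have half z z' : r z != r z' ->
    adj g z z' = adj g (r z) z' && ((r z \in W) ==> (z == r z)).
  move=> zz'; have [<-|zr] := eqVneq z (r z); first by rewrite implybT andbT.
  rewrite eq_sym in zr; rewrite implybF; case: (boolP (r z \in W)) => rW.
    rewrite andbF -in_nbhd fW // inE; apply: contraNF zz' => /eqP ->.
    by rewrite rr.
  rewrite andbT; have rU : r z \in U by case/orP: (moved zr) => //; rewrite (negbTE rW).
  have := in_cnbhd g z z'; rewrite fU // in_cnbhd.
  have -> : z' == z = false by apply: contraNF zz' => /eqP ->.
  by have -> : z' == r z = false by apply: contraNF zz' => /eqP ->; rewrite rr.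
rewrite [RHS]half // [adj g (r x) y]gC half ?rr 1?eq_sym // gC.
by rewrite -andbA [in RHS](andbC (_ ==> _)).
Qed.

(** Every other point is removable with its center as witness. A graph and its exchange agree on the
    centers, so this transfers the reduction. *)
Lemma dismantles_image (VR : finType) (eR : rel VR) (g : graph n) :
    (forall v, ~~ is_leaf eR v) ->
    (forall u v, cnbhd eR u = cnbhd eR v -> u = v) ->
    simple_graph (adj g) -> fits g (r, U, W) ->
  dismantles eR (adj g) setT <-> dismantles eR (adj g) [set x | r x == x].
Proof.
move=> nl ns gs fB.
have -> : [set x | r x == x] = setT :\: [set x | r x != x].
  by apply/setP=> x; rewrite !inE negbK andbT.
apply: dismantles_setD => // x; rewrite inE => ne; exists (r x).
  by rewrite !inE negbK rr eqxx.
have xr : x != r x by rewrite eq_sym.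
case/orP: (moved ne) => rx; [left|right].
  have E := fits_cnbhd fB rx; split=> //; first exact: cnbhd_adj E xr.
  move=> z _ zx zr; have := in_cnbhd g x z; rewrite E in_cnbhd.
  by rewrite (negbTE zx) (negbTE zr).
have E := fits_nbhd fB rx ne; split=> //; first by rewrite -in_nbhd E inE.
by move=> z _; rewrite -in_nbhd E inE => /eqP.
Qed.

End Expand.

(** * Invariance under relabeling *)

Lemma relabelE n (g : graph n) (s : {perm 'I_n}) x y :
  adj (relabel g s) (s x) (s y) = adj g x y.
Proof. by rewrite /adj ffunE /= !permK. Qed.

Lemma cnbhd_relabel n (g : graph n) (s : {perm 'I_n}) x :
  cnbhd (adj (relabel g s)) (s x) = s @: cnbhd (adj g) x.
Proof.
apply/setP=> y; rewrite -[y](permKV s) (mem_imset _ _ perm_inj) !in_cnbhd.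
by rewrite relabelE (inj_eq perm_inj).
Qed.

Lemma is_leaf_relabel n (g : graph n) (s : {perm 'I_n}) x :
  is_leaf (adj (relabel g s)) (s x) = is_leaf (adj g) x.
Proof.
rewrite /is_leaf -(card_imset (nbhd (adj g) x) (@perm_inj _ s)).
congr (_ == _); apply: eq_card => y.
by rewrite -[y](permKV s) (mem_imset _ _ perm_inj) !in_nbhd relabelE.
Qed.

Lemma sibling_relabel n (g : graph n) (s : {perm 'I_n}) :
  sibling (adj (relabel g s)) = sibling (adj g).
Proof.
congr (_ - 1); rewrite (reindex_inj (@perm_inj _ s)) /=; apply: eq_bigr => v _.
rewrite -[RHS](card_imset _ (@perm_inj _ s)); apply: eq_card => u.
rewrite -[u](permKV s) (mem_imset _ _ perm_inj) !inE !cnbhd_relabel.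
by rewrite (inj_eq (imset_inj perm_inj)).
Qed.

Lemma tuft_relabel n (g : graph n) (s : {perm 'I_n}) :
  tuft (adj (relabel g s)) = tuft (adj g).
Proof.
rewrite /tuft (reindex_inj (@perm_inj _ s)) /=; apply: eq_bigr => v _.
rewrite -[RHS](card_imset _ (@perm_inj _ s)); apply: eq_card => u.
by rewrite -[u](permKV s) (mem_imset _ _ perm_inj) !inE relabelE is_leaf_relabel.
Qed.

Lemma simple_relabel n (g : graph n) (s : {perm 'I_n}) :
  simple_graph (adj g) -> simple_graph (adj (relabel g s)).
Proof.
move=> gs; apply/andP; split; apply/forallP=> x; rewrite -[x](permKV s).
  by rewrite relabelE (simple_irr gs).
by apply/forallP=> y; rewrite -[y](permKV s) !relabelE (simple_sym gs).
Qed.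

Lemma sum_levels (T : finType) (P : pred T) (f F : T -> nat) a :
  \sum_(i < a) \sum_(g | P g && (f g == i)) F g = \sum_(g | P g && (f g < a)) F g.
Proof.
elim: a => [|a IH]; first by rewrite big_ord0 big1 // => g; rewrite andbF.
rewrite big_ord_recr /= IH [RHS](bigID (fun g => f g < a)) /=.
congr (_ + _); apply: eq_bigl => g; rewrite -andbA ltnS; congr (_ && _).
  by apply/esym/andb_idl => /ltnW.
by rewrite -leqNgt -eqn_leq.
Qed.

(** * From signed counts to isomorphism classes *)

Section Symmetry.
Variables (VR : finType) (eR : rel VR) (n : nat).
Hypotheses (conR : connectedb eR) (leafless : forall v, ~~ is_leaf eR v).
Hypothesis sibless : forall u v, cnbhd eR u = cnbhd eR v -> u = v.
Hypotheses (n0 : 0 < n) (n2 : n != 2).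

Definition reduces_graph (g : graph n) :=
  [&& simple_graph (adj g), connectedb (adj g), ~~ isK2 (adj g)
    & reduces_to (adj g) eR].

Lemma reduces_graph_nal g : reduces_graph g -> no_adjacent_leaves (adj g) setT.
Proof. by case/and4P=> _ c k _; exact: connected_no_adjacent_leaves. Qed.

(** Connectedness is inherited from [eR] along the removals and [n != 2] rules out [K_2], so what
    has to be transported is a dismantling. *)
Lemma reduces_graphP g :
  reflect (simple_graph (adj g) /\ dismantles eR (adj g) setT) (reduces_graph g).
Proof.
apply: (iffP idP) => [rg|[gs D]].
  have nal := reduces_graph_nal rg; case/and4P: rg => gs _ _ R.
  by split=> //; apply/reduces_toP.
have con : connectedb (adj g).
  rewrite /connectedb card_ord n0; apply/forallP=> x; apply/forallP=> y.
  by apply: (dismantles_connect gs conR D).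
have nK2 : ~~ isK2 (adj g) by rewrite /isK2 card_ord (negbTE n2).
apply/and4P; split=> //; apply/reduces_toP => //.
exact: connected_no_adjacent_leaves.
Qed.

Lemma reduces_graph_relabel g s : reduces_graph (relabel g s) = reduces_graph g.
Proof.
suff half h t : reduces_graph h -> reduces_graph (relabel h t).
  apply/idP/idP => [/(half _ (s^-1)%g)|]; last exact: half.
  by rewrite -relabelM mulgV relabel1.
case/reduces_graphP=> hs D; apply/reduces_graphP; split; first exact: simple_relabel.
have -> : setT = t @: [set: 'I_n].
  by apply/setP=> x; rewrite -[x](permKV t) (mem_imset _ _ perm_inj) !inE.
apply: dismantles_morph D => [x y _ _|x y _ _]; first exact: perm_inj.
by rewrite relabelE.
Qed.

Lemma expand_reduces a b (B : config n) g : is_config a b B -> fits g B ->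
  reduces_graph g -> reduces_graph (expand (swap B) g).
Proof.
case: B => [[r U] W] cB fB /reduces_graphP[gs D]; apply/reduces_graphP.
have cB' : is_config b a (r, W, U).
  by rewrite -[X in is_config _ _ X]/(swap (r, U, W)) swap_is_config.
have es := expand_simple r W U gs; have ef := expand_fits cB' g; split=> //.
apply/(dismantles_image cB' leafless sibless es ef).
move/(dismantles_image cB leafless sibless gs fB): D => D.
rewrite -[X in dismantles _ _ X]imset_id; apply: dismantles_morph D => // x y.
rewrite !inE => /eqP rx /eqP ry; rewrite /adj ffunE /= rx ry !eqxx !implybT !andbT.
case: (eqVneq x y) => // ->; exact: simple_irr gs y.
Qed.

Definition good_pair a b s (p : graph n * config n) :=
  [&& reduces_graph p.1, s \in automorphisms p.1, is_config a b p.2,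
      fits p.1 p.2 & fixes s p.2].

Definition swap_pair (p : graph n * config n) := (expand (swap p.2) p.1, swap p.2).

Lemma swap_pairP a b s p : good_pair a b s p ->
  good_pair b a s (swap_pair p) /\ swap_pair (swap_pair p) = p.
Proof.
case: p => g [[r U] W] /and5P[].
rewrite -[(g, _).1]/g -[(g, _).2]/(r, U, W) => rg sA cB fB fx.
have cB' : is_config b a (r, W, U).
  by rewrite -[X in is_config _ _ X]/(swap (r, U, W)) swap_is_config.
have gs : simple_graph (adj g) by case/and4P: rg.
have fx' : fixes s (r, W, U) by case/fixesP: fx => *; apply/fixesP.
split; last first.
  have := expand_swap cB' g; rewrite (fits_expand cB gs fB).
  exact: (congr1 (pair^~ (r, U, W))).
apply/and5P; split=> //; first exact: (expand_reduces cB fB rg).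
  exact: expand_automorphism fx' sA.
exact: expand_fits cB' g.
Qed.

Definition signed_count a b : int :=
  (\sum_(s : {perm 'I_n}) \sum_(p | good_pair a b s p) cycle_sign s (centers p.2))%R.

(** The exchange keeps [s] and the set of centers, hence the sign; only the two kinds, and with them
    [a] and [b], change places. *)
Lemma signed_countC a b : signed_count a b = signed_count b a.
Proof.
apply: eq_bigr => s _; rewrite (reindex_onto swap_pair swap_pair) /=; last first.
  by move=> p /swap_pairP[].
apply: eq_big => [p|p _]; last by rewrite /centers /swap_pair /= setUC.
apply/andP/idP => [[/swap_pairP[gp _] /eqP E]|/swap_pairP[gp E]].
  by rewrite E in gp.
by rewrite E.
Qed.

Definition aut_count a b :=
  \sum_(g | (reduces_graph g && (sibling (adj g) < a)) && (tuft (adj g) < b))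
    #|automorphisms g|.

(** Summed over [s] and the configurations, each graph contributes the order of its automorphism
    group or zero. The bounds in [aut_count] are strict, hence the successors. *)
Lemma signed_countE a b : signed_count a b = ((aut_count a.+1 b.+1)%:R)%R.
Proof.
transitivity (\sum_(s : {perm 'I_n}) \sum_(g | reduces_graph g && (s \in automorphisms g))
  \sum_(B : config n | [&& is_config a b B, fits g B & fixes s B])
     cycle_sign s (centers B))%R.
  apply: eq_bigr => s _; rewrite pair_big_dep /=; apply: eq_bigl => p.
  by rewrite /good_pair -!andbA.
rewrite (exchange_big_dep (fun g => reduces_graph g)) /=; last by move=> s g _ /andP[].
rewrite /aut_count natr_sum [RHS]big_mkcondr [RHS]big_mkcondr /=; apply: eq_bigr => g rg.
have gs : simple_graph (adj g) by case/and4P: rg.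
transitivity (\sum_(s in automorphisms g)
  ((sibling (adj g) <= a)%N && (tuft (adj g) <= b)%N)%:R : int)%R.
  rewrite -(config_sum gs (reduces_graph_nal rg)) //.
  by apply: eq_bigl => s; rewrite rg.
rewrite !ltnS; case: (sibling _ <= a); last by rewrite big1.
by case: (tuft _ <= b); [rewrite sumr_const | rewrite big1].
Qed.

Lemma aut_countC a b : aut_count a b = aut_count b a.
Proof.
(* The signed count covers positive bounds; with a zero bound both sums are empty. *)
case: a b => [|a] [|b] //; last first.
- by apply/eqP; rewrite -(eqr_nat int) -!signed_countE signed_countC.
- by rewrite /aut_count !big1 // => g; rewrite ?andbF ?ltn0.
by rewrite /aut_count !big1 // => g; rewrite ?andbF ?ltn0.
Qed.

Definition aut_level a b :=
  \sum_(g | (reduces_graph g && (sibling (adj g) == a)) && (tuft (adj g) == b))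
    #|automorphisms g|.

Lemma sum_aut_level a b :
  \sum_(i < a) \sum_(j < b) aut_level i j = aut_count a b.
Proof.
under eq_bigr => i _ do rewrite sum_levels.
under eq_bigr => i _ do under eq_bigl => g do rewrite andbAC.
by rewrite sum_levels; apply: eq_bigl => g; rewrite andbAC.
Qed.

Lemma aut_levelC a b : aut_level a b = aut_level b a.
Proof.
apply: (@sum_prefix2_inj aut_level (fun i j => aut_level j i)) => c d.
by rewrite sum_aut_level aut_countC exchange_big /= sum_aut_level.
Qed.

Lemma in_graphs_st a b g : (g \in graphs_st eR n a b) =
  (reduces_graph g && (sibling (adj g) == a)) && (tuft (adj g) == b).
Proof. by rewrite inE /reduces_graph -!andbA. Qed.

Lemma giso_orbit g :
  [set h | giso g h] = orbit (relabel_action n) [set: {perm 'I_n}] g.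
Proof.
apply/setP=> h; rewrite inE; apply/existsP/orbitP => [[p /forallP H]|[p _ <-]].
  exists p; rewrite ?inE //; apply/ffunP=> -[x y]; rewrite ffunE /=.
  have /forallP/(_ ((p^-1)%g y))/eqP -> := H ((p^-1)%g x).
  by rewrite !permKV.
exists p; apply/forallP=> x; apply/forallP=> y.
by rewrite /= ffunE /= !permK.
Qed.

(** Burnside's lemma: the pairs of a graph and one of its automorphisms number [n!] times the orbits
    of the symmetric group. *)
Lemma num_classes_aut a b : num_classes eR n a b * n`! = aut_level a b.
Proof.
set S := graphs_st eR n a b.
have actS : [acts [set: {perm 'I_n}], on S | relabel_action n]%g.
  apply/actsP=> s _ g; rewrite !in_graphs_st /=.
  by rewrite reduces_graph_relabel sibling_relabel tuft_relabel.
have orbS g : g \in S -> [set h in S | giso g h] =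
    orbit (relabel_action n) [set: {perm 'I_n}] g.
  move=> gS; rewrite -giso_orbit; apply/setP=> h; rewrite !inE andbC.
  apply: andb_idr => gh; have : h \in [set h | giso g h] by rewrite inE.
  by rewrite giso_orbit => /orbitP[s _ <-]; have := actsP actS s (in_setT _) g; rewrite gS inE.
have -> : num_classes eR n a b = #|orbit (relabel_action n) [set: {perm 'I_n}] @: S|.
  by congr #|pred_of_set _|; apply: eq_in_imset.
have := Frobenius_Cauchy actS; rewrite cardsT card_Sn => <-.
transitivity (\sum_(s in [set: {perm 'I_n}])
  \sum_(g | (g \in S) && (s \in automorphisms g)) 1).
  apply: eq_bigr => s _; rewrite -sum1_card; apply: eq_bigl => g.
  by rewrite inE; congr (_ && _); apply/afix1P/astab1P.
rewrite (exchange_big_dep [in S]) /=; last by move=> s g _ /andP[].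
rewrite /aut_level; apply: eq_big => [g|g gS]; first by rewrite in_graphs_st.
by rewrite -sum1_card; apply: eq_bigl => s; rewrite inE gS.
Qed.

End Symmetry.

(** A connected graph on two vertices is [K_2], which [graphs_st] excludes. *)
Lemma graphs_st2 (VR : finType) (eR : rel VR) a b : graphs_st eR 2 a b = set0.
Proof.
apply/setP=> g; rewrite !inE; apply/negbTE/negP => /and5P[gs con nK2 _ _].
case/negP: nK2; rewrite /isK2 card_ord eqxx /=.
apply/existsP; exists ord0; apply/existsP; exists ord_max; rewrite /=.
case/andP: con => _ /forallP/(_ ord0)/forallP/(_ ord_max)/connectP[[|x p] //= /andP[e0x _] _].
suff <- : x = ord_max by [].
apply/val_inj; case: x e0x => -[|[|//]] // i; rewrite (_ : Ordinal i = ord0).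
  by rewrite (simple_irr gs).
exact: val_inj.
Qed.

Theorem theorem1p2 (VR : finType) (eR : rel VR)
  (hsimple : simple_graph eR) (hconn : connectedb eR)
  (hnoleaf : forall v : VR, ~~ is_leaf eR v)
  (hnosib : forall u v : VR, cnbhd eR u = cnbhd eR v -> u = v)
  (n : nat) (hn : (1 <= n)%N) :
  forall a b : nat, num_classes eR n a b = num_classes eR n b a.
Proof.
move=> a b; have [->|n2] := eqVneq n 2.
  by rewrite /num_classes !graphs_st2 !imset0.
have n_fact := fact_gt0 n; apply/eqP; rewrite -(eqn_pmul2r n_fact); apply/eqP.
rewrite !(num_classes_aut hconn hnoleaf hnosib hn n2).
exact: aut_levelC.
Qed.
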